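(* For $n$ sufficiently large, the Turán number of $TP_4$ satisfies \[\mathrm{ex}(n,TP_4)=\frac{1}{4}n^2+\Theta(n^{4/3}).\]
   Context: All graphs are simple. For a graph $H$, $\mathrm{ex}(n,H)$ denotes the maximum number of edges in an $n$-vertex graph containing no copy of $H$ as a subgraph. The triangular pyramid with $k$ layers, $TP_k$, is defined as follows: for each $i\in\{1,\dots,k+1\}$ take a path $P_i=y^i_1y^i_2\cdots y^i_i$ on $i$ vertices (the $i$-th layer; all these vertices are distinct), and for each $i\in\{1,\dots,k\}$ and each $t\in\{1,\dots,i\}$ add the edges $y^i_ty^{i+1}_t$ and $y^i_ty^{i+1}_{t+1}$. Thus $TP_4$ has $15$ vertices. *)

(* Defs.v *)
From mathcomp Require Import all_boot.

Set Implicit Arguments.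
Unset Strict Implicit.
Unset Printing Implicit Defensive.

(* A finite simple graph on the vertex type T is given by its edge set,
   a set of two-element sets of vertices. *)
Definition simple_graph (T : finType) (G : {set {set T}}) : bool :=
  [forall e in G, #|e| == 2].

(* G contains a copy of H as a (not necessarily induced) subgraph. *)
Definition contains_copy (V T : finType)
    (H : {set {set V}}) (G : {set {set T}}) : bool :=
  [exists f : {ffun V -> T}, injectiveb f && [forall e in H, f @: e \in G]].

(* The Turan number ex(n, H). When H has an edge, the empty graph is
   H-free, so the maximum is over a nonempty family. *)
Definition ex (n : nat) (V : finType) (H : {set {set V}}) : nat :=
  \max_(G : {set {set 'I_n}} | simple_graph G && ~~ contains_copy H G) #|G|.

(* Indices are shifted to start from 0: the vertex y^(i+1)_(t+1), with
   0 <= t <= i <= k, is Tagged _ t with tag i. *)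
Definition TP_vertex (k : nat) : finType := {i : 'I_k.+1 & 'I_i.+1}.

Definition layer (k : nat) (x : TP_vertex k) : nat := tag x.
Definition pos (k : nat) (x : TP_vertex k) : nat := tagged x.

(* The first disjunct gives the edges of the path on a layer, the second one
   the two edges from a vertex to the next layer. *)
Definition TP_arc (k : nat) (x y : TP_vertex k) : bool :=
     (layer y == layer x) && (pos y == (pos x).+1)
  || (layer y == (layer x).+1) && ((pos y == pos x) || (pos y == (pos x).+1)).

Definition TP (k : nat) : {set {set TP_vertex k}} :=
  [set [set x; y] | x in TP_vertex k, y in TP_vertex k & TP_arc x y].

Lemma TP_simple (k : nat) : simple_graph (TP k).
Proof.
apply/forallP => e; apply/implyP => /imset2P[x y _].
rewrite inE => /andP[_ xy] ->; rewrite cards2; have [eq_xy|//] := eqVneq x y.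
by move: xy; rewrite eq_xy /TP_arc !(ltn_eqF (ltnSn _)) andbF.
Qed.

(* Main.v *)
(* Lower bound: inside one part of K_{n/2,n/2} put the incidence graph of the
   points of F^3 and the lines with a direction (1, x, x^2), which has q^4 edges
   and no hexagon, as three such directions are independent. The three interior
   vertices of TP_4 are pairwise adjacent and both parts miss triangles, so
   exactly one of them falls in the other part, and its six neighbours form a
   hexagon in the incidence graph.

   Upper bound: after deletion of vertices of degree below half, only boundedly
   many vertices have a neighbourhood with quadratically many edges, as otherwise
   K_{5,5,5} appears. The neighbourhood of any other vertex and its complement
   then form a bipartition which, up to boundedly many vertices, has small inner
   degrees. One part spans at least c n^{4/3} edges, hence contains a hexagon
   with two pendant paths, and five common neighbours of these ten vertices in
   the other part complete it to TP_4. *)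
Require Import Defs.
From mathcomp Require Import all_boot all_order all_algebra all_field.
From mathcomp Require Import zify ring lra.
From mathcomp Require Import reals exp.

Set Implicit Arguments.
Unset Strict Implicit.
Unset Printing Implicit Defensive.

(** * Degrees inside a set of vertices *)

Section Degree.
Variables (T : finType) (e : rel T).
Implicit Types (S A B : {set T}) (x y : T).

Definition nbr S x := [set y in S | e x y].
Definition deg S x := #|nbr S x|.
(** Counts ordered adjacent pairs, so for a simple graph it is twice the number of edges inside
    [S]. *)
Definition degsum S := \sum_(x in S) deg S x.

Lemma degE S x : deg S x = \sum_(y in S) e x y.
Proof.
rewrite /deg /nbr -sum1_card -big_mkcondr /=.
by apply: eq_bigl => y; rewrite inE.
Qed.

Lemma nbr_sub S x : nbr S x \subset S.
Proof. by apply/subsetP => y; rewrite inE => /andP[]. Qed.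

Lemma deg_sub A B x : A \subset B -> deg A x <= deg B x.
Proof.
move=> AB; apply/subset_leq_card/subsetP => y; rewrite !inE.
by case/andP=> /(subsetP AB) -> ->.
Qed.

Lemma deg_le_card S x : deg S x <= #|S|.
Proof. exact/subset_leq_card/nbr_sub. Qed.

Lemma deg_setID A S x : deg S x = deg (S :&: A) x + deg (S :\: A) x.
Proof. by rewrite !degE (big_setID A). Qed.

Lemma deg_cover A B x : deg A x <= deg B x + #|A :\: B|.
Proof.
rewrite (deg_setID B) leq_add ?deg_le_card //.
by rewrite deg_sub ?subsetIr.
Qed.

Lemma exchange_deg A B : symmetric e ->
  \sum_(x in A) deg B x = \sum_(y in B) deg A y.
Proof.
move=> esym; rewrite (eq_bigr (fun x => \sum_(y in B) e x y)) => [|x _]; last first.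
  exact: degE.
rewrite exchange_big /=; apply: eq_bigr => y _; rewrite degE.
by apply: eq_bigr => x _; rewrite esym.
Qed.

Lemma degsum_sub A B : A \subset B -> degsum A <= degsum B.
Proof.
move=> AB; rewrite /degsum (big_setID A (A := B)) (setIidPr AB).
by apply: leq_trans (leq_addr _ _); apply: leq_sum => x _; apply: deg_sub.
Qed.

Lemma degsum_setD A B : A \subset B ->
  degsum B <= degsum A + 2 * #|B :\: A| * #|B|.
Proof.
move=> AB; rewrite /degsum (big_setID A (A := B)) (setIidPr AB) /=.
have le1 : \sum_(x in A) deg B x <= \sum_(x in A) deg A x + #|B| * #|B :\: A|.
  apply: (@leq_trans (\sum_(x in A) (deg A x + #|B :\: A|))).
    by apply: leq_sum => x _; apply: deg_cover.
  by rewrite big_split sum_nat_const /= leq_add2l leq_mul2r subset_leq_card ?orbT.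
have le2 : \sum_(x in B :\: A) deg B x <= #|B :\: A| * #|B|.
  by rewrite -sum_nat_const; apply: leq_sum => x _; apply: deg_le_card.
by move: le1 le2; lia.
Qed.

Lemma sumU A B (F : T -> nat) : [disjoint A & B] ->
  \sum_(x in A :|: B) F x = \sum_(x in A) F x + \sum_(x in B) F x.
Proof. by move=> dAB; rewrite -bigU //; apply: eq_bigl => x; rewrite !inE. Qed.

Lemma degsum_setU A B : symmetric e -> [disjoint A & B] ->
  degsum (A :|: B) <= degsum A + degsum B + 2 * (#|A| * #|B|).
Proof.
move=> esym dAB; rewrite /degsum.
have degU x : deg (A :|: B) x = deg A x + deg B x.
  by rewrite !degE sumU.
have le1 : \sum_(x in A) deg B x <= #|A| * #|B|.
  by rewrite -sum_nat_const; apply: leq_sum => x _; apply: deg_le_card.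
rewrite sumU // (eq_bigr (fun x => deg A x + deg B x)) // big_split /=.
rewrite [X in _ + X](eq_bigr (fun x => deg A x + deg B x)) // big_split /=.
rewrite -(exchange_deg A B esym); lia.
Qed.

Lemma degsumD1 S x : symmetric e -> irreflexive e -> x \in S ->
  degsum S = degsum (S :\ x) + 2 * deg S x.
Proof.
move=> esym eirr xS; rewrite /degsum (big_setD1 x xS) /=.
have degD y : deg S y = deg (S :\ x) y + e y x.
  by rewrite !degE (big_setD1 x xS) addnC.
rewrite (eq_bigr (fun y => deg (S :\ x) y + e y x)) // big_split /=.
rewrite -[X in _ + (_ + X)]/(\sum_(y in S :\ x) e y x).
have -> : \sum_(y in S :\ x) e y x = deg S x.
  rewrite degE (big_setD1 x xS) /= eirr add0n.
  by apply: eq_bigr => y _; rewrite esym.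
lia.
Qed.

Lemma minimal_subset (P : pred {set T}) S : P S ->
  exists A, [/\ A \subset S, P A & forall x, x \in A -> ~~ P (A :\ x)].
Proof.
move=> /minset_exists[A /minsetP[PA minA] AS]; exists A; split=> // x xA.
apply/negP => /minA /(_ (subD1set _ _)) eqA.
by move: xA; rewrite -eqA setD11.
Qed.

(** A minimal subset of this density has no vertex [x] of degree at most [k]: deleting [x] lowers
    the degree sum by [2 * deg e A x] and the bound by [2 * k]. *)
Lemma min_degree_core S k : symmetric e -> irreflexive e ->
  2 * k * #|S| < degsum S ->
  exists A, [/\ A \subset S, A != set0 & forall x, x \in A -> k < deg A x].
Proof.
move=> esym eirr /(@minimal_subset (fun S => 2 * k * #|S| < degsum S)).
case=> A [AS PA minA]; exists A; split=> // [|x xA].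
  apply/eqP => A0; move: PA; rewrite A0 /degsum big_set0; lia.
move: (minA x xA) PA; rewrite (degsumD1 esym eirr xA) (cardsD1 x A) xA; nia.
Qed.

(** Deleting [x] lowers [#|A| ^ 2] by [2 * #|A| - 1] and the right side by [4 * deg e A x], so a
    vertex of degree below half can be removed. The surplus [K] survives and later forces the
    remaining set to be large. *)
Lemma half_degree S K : symmetric e -> irreflexive e ->
  #|S| ^ 2 + K <= 2 * degsum S ->
  exists A, [/\ A \subset S, #|A| ^ 2 + K <= 2 * degsum A &
                forall x, x \in A -> #|A| <= 2 * deg A x].
Proof.
move=> esym eirr /(@minimal_subset (fun S => #|S| ^ 2 + K <= 2 * degsum S)).
case=> A [AS PA minA]; exists A; split=> // x xA.
move: (minA x xA) PA; rewrite (degsumD1 esym eirr xA) (cardsD1 x A) xA; nia.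
Qed.

End Degree.

Lemma eq_degsum (T : finType) (e e' : rel T) (S : {set T}) :
  {in S &, e =2 e'} -> degsum e S = degsum e' S.
Proof.
move=> ee'; apply: eq_bigr => x xS; rewrite !degE.
by apply: eq_bigr => y yS; rewrite ee'.
Qed.

(** * Bipartite subgraphs with half of the edges *)

Definition cut (T : finType) (e : rel T) (X : {set T}) : rel T :=
  fun x y => e x y && ((x \in X) != (y \in X)).

Lemma cut_sym (T : finType) (e : rel T) (X : {set T}) :
  symmetric e -> symmetric (cut e X).
Proof. by move=> esym x y; rewrite /cut esym eq_sym. Qed.

Lemma cut_irr (T : finType) (e : rel T) (X : {set T}) : irreflexive (cut e X).
Proof. by move=> x; rewrite /cut eqxx andbF. Qed.

(** Greedy induction: [x] joins the side holding at most half of its neighbours, so at least half of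
    its edges to [S] are cut. *)
Lemma half_cut (T : finType) (e : rel T) (S : {set T}) :
  symmetric e -> irreflexive e ->
  exists X, degsum e S <= 2 * degsum (cut e X) S.
Proof.
move=> esym eirr; have [n] := ubnP #|S|; elim: n S => // n IH S.
have [-> _|[x xS] ltS] := set_0Vmem S; first by exists set0; rewrite /degsum big_set0.
have [|X leX] := IH (S :\ x); first by move: ltS; rewrite (cardsD1 x S) xS.
have split_deg : deg e S x = deg e (S :&: X) x + deg e (S :\: X) x.
  exact: deg_setID.
have csym (Y : {set T}) := cut_sym Y esym; have cirr (Y : {set T}) := @cut_irr _ e Y.
have eqS (Y : {set T}) : {in S :\ x, forall y, (y \in Y) = (y \in X)} ->
    degsum (cut e Y) (S :\ x) = degsum (cut e X) (S :\ x).
  by move=> YX; apply: eq_degsum => y z yS zS; rewrite /cut !YX.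
case: (leqP (deg e (S :&: X) x) (deg e (S :\: X) x)) => le_deg.
  exists (x |: X); rewrite (degsumD1 esym eirr xS) (degsumD1 (csym _) (cirr _) xS).
  rewrite eqS => [|y]; last by rewrite !inE => /andP[/negPf->].
  have : deg e (S :\: X) x <= deg (cut e (x |: X)) S x.
    apply/subset_leq_card/subsetP => y; rewrite /cut !inE eqxx /=.
    case/andP=> /andP[yX ->] exy; rewrite exy /=.
    rewrite (negPf yX) orbF; case: (y =P x) => // yx; by rewrite yx eirr in exy.
  by lia.
exists (X :\ x); rewrite (degsumD1 esym eirr xS) (degsumD1 (csym _) (cirr _) xS).
rewrite eqS => [|y]; last by rewrite !inE => /andP[->].
have : deg e (S :&: X) x <= deg (cut e (X :\ x)) S x.
  apply/subset_leq_card/subsetP => y; rewrite /cut !inE eqxx /=.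
  case/andP=> /andP[-> yX] exy; rewrite exy yX andbT /=.
  case: (y =P x) => // yx; by rewrite yx eirr in exy.
by lia.
Qed.

(** * Hexagons in bipartite graphs of large minimum degree *)

Lemma pick_nbr (T : finType) (e : rel T) (S : {set T}) x (s : seq T) :
  size s < deg e S x -> exists y, [/\ y \in S, e x y & y \notin s].
Proof.
move=> lt_s; have [/subset_leq_card|] := boolP (nbr e S x \subset [set y in s]).
  by move=> le_s; move: lt_s; rewrite ltnNge (leq_trans le_s) // cardsE card_size.
by case/subsetPn=> y; rewrite !inE => /andP[yS exy] ys; exists y.
Qed.

Section Hexagon.
Variables (T : finType) (r : rel T).
Hypothesis (rsym : symmetric r).

Definition has_hexagon := exists2 s : seq T, size s = 6 & uniq s /\ cycle r s.

(** With more than twice as many edges as vertices there is a core of minimum degree at least 3,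
    where a path can be continued four times while avoiding the at most two earlier vertices of the
    side entered. *)
Lemma zigzag (A B : {set T}) : [disjoint A & B] ->
  2 * (#|A| + #|B|) < \sum_(x in A) deg r B x ->
  exists a0 b1 a2 b3 a4,
    [/\ [/\ a0 \in A, b1 \in B, a2 \in A, b3 \in B & a4 \in A],
        [/\ r a0 b1, r b1 a2, r a2 b3 & r b3 a4],
        uniq [:: a0; a2; a4] & b1 != b3].
Proof.
move=> dAB big.
pose r' := [rel x y | r x y && ((x \in A) && (y \in B) || (x \in B) && (y \in A))].
have r'sym : symmetric r' by move=> x y; rewrite /= rsym orbC ![(_ \in A) && _]andbC.
have notAB x : x \in A -> x \notin B by move/(disjointFr dAB)->.
have r'irr : irreflexive r'.
  move=> x /=; have [/notAB/negPf->|_] := boolP (x \in A); by rewrite ?andbF.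
have [|C [_ /set0Pn[x xC] degC]] := @min_degree_core _ r' (A :|: B) 2 r'sym r'irr.
  rewrite /degsum sumU // cardsU disjoint_setI0 // cards0 subn0.
  have leA : \sum_(x in A) deg r B x <= \sum_(x in A) deg r' (A :|: B) x.
    apply: leq_sum => x xA; apply/subset_leq_card/subsetP => y.
    by rewrite !inE /= xA => /andP[-> ->]; rewrite orbT.
  have leB : \sum_(x in B) deg r A x <= \sum_(x in B) deg r' (A :|: B) x.
    apply: leq_sum => x xB; apply/subset_leq_card/subsetP => y.
    by rewrite !inE /= xB => /andP[-> ->]; rewrite /= orbT.
  move: big leA leB; rewrite -(exchange_deg A B rsym); lia.
have [a aC aA] : exists2 a, a \in C & a \in A.
  have [y [yC /= /andP[_ /orP[]/andP[xA yA]] _]] :=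
      @pick_nbr _ r' C x [::] (ltnW (ltnW (degC _ xC))).
    by exists x.
  by exists y.
have stepA y (s : seq T) : y \in C -> y \in A -> size s <= 2 ->
    exists z, [/\ z \in C, z \in B, r y z & z \notin s].
  move=> yC yA les; have [|z [zC /= /andP[ryz]]] := @pick_nbr _ r' C y s.
    exact: leq_ltn_trans (degC _ yC).
  by rewrite yA (negPf (notAB _ yA)) orbF => zB; exists z.
have stepB y (s : seq T) : y \in C -> y \in B -> size s <= 2 ->
    exists z, [/\ z \in C, z \in A, r y z & z \notin s].
  move=> yC yB les; have [|z [zC /= /andP[ryz]]] := @pick_nbr _ r' C y s.
    exact: leq_ltn_trans (degC _ yC).
  by rewrite yB (disjointFl dAB yB) /= => zA; exists z.
have [b1 [b1C b1B rab1 _]] := stepA a [::] aC aA isT.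
have [a2 [a2C a2A rb1a2]] := stepB b1 [:: a] b1C b1B isT.
rewrite inE => a2a.
have [b3 [b3C b3B ra2b3]] := stepA a2 [:: b1] a2C a2A isT.
rewrite inE => b3b1.
have [a4 [a4C a4A rb3a4]] := stepB b3 [:: a; a2] b3C b3B isT.
rewrite !inE negb_or => /andP[a4a a4a2].
exists a, b1, a2, b3, a4; split=> //; last by rewrite eq_sym.
by rewrite /= !inE negb_or ![a == _]eq_sym a2a a4a eq_sym a4a2.
Qed.

Variables (c : T -> bool) (S : {set T}) (D : nat) (x : T).
Hypothesis rcol : forall u v, r u v -> c u != c v.
Hypothesis rS : forall u v, r u v -> v \in S.
Hypothesis degS : forall u, u \in S -> D <= deg r S u.
Hypothesis xS : x \in S.
Hypothesis D12 : 12 <= D.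

(* Breadth-first search from [x]: a path of length 2 or 4 between two vertices
   of the same level closes up to a hexagon through their parents. *)
Let L1 := nbr r S x.
Let L2 := [set u in S | (u != x) && [exists y in L1, r y u]].
Let L3 := [set w in S | (w \notin L1) && [exists u in L2, r u w]].

(** Without a hexagon, consecutive levels span at most twice as many edges as vertices, so from
    [#|L1| >= D] on each level is at least [D / 4] times the previous one. Then [#|L3|] is at least
    [D ^ 3 / 16], more than [#|S|]. *)
Lemma hexagon_of_degree : 16 * #|S| < D ^ 3 -> has_hexagon.
Proof.
move=> ltS.
have [hex|nohex] := boolP [exists t : 6.-tuple T, uniq t && cycle r t].
  case/existsP: hex => t /andP[ut ct]; exists (val t) => //; exact: size_tuple.
have cN u v : r u v -> c v = ~~ c u by move/rcol; case: (c u); case: (c v).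
have neqc u v : c u = ~~ c v -> u != v.
  by move=> cuv; apply/eqP => uv; move: cuv; rewrite uv; case: (c v).
(* The colouring [c] separates even from odd positions, so distinctness is only needed within each
   parity. *)
have {}nohex v0 v1 v2 v3 v4 v5 : cycle r [:: v0; v1; v2; v3; v4; v5] ->
    uniq [:: v0; v2; v4] -> uniq [:: v1; v3; v5] -> False.
  move=> cv u024 u135; case/existsP: nohex.
  exists [tuple v0; v1; v2; v3; v4; v5]; rewrite cv andbT.
  move: cv; rewrite /= => /and4P[/cN c1 /cN c2 /cN c3 /and3P[/cN c4 /cN c5 _]].
  move: u024 u135; rewrite /= !inE !negb_or !andbT.
  case/andP=> /andP[-> ->] -> /andP[/andP[-> ->] ->].
  by rewrite !neqc // ?c5 ?c4 ?c3 ?c2 ?c1 ?negbK.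
have L1P u : u \in L1 -> r x u /\ c u = ~~ c x.
  by rewrite inE => /andP[_ rxu]; split=> //; apply: cN.
have L2P u : u \in L2 -> u != x /\ c u = c x.
  rewrite inE => /and3P[_ -> /exists_inP[y /L1P[_ cy] /cN->]].
  by rewrite cy negbK.
have L3P w : w \in L3 -> w \notin L1 /\ c w = ~~ c x.
  rewrite inE => /and3P[_ -> /exists_inP[y /L2P[_ cy] /cN->]].
  by rewrite cy.
have d12 : [disjoint L1 & L2].
  rewrite -setI_eq0; apply/eqP/setP => u; rewrite in_set0 in_setI.
  apply/negP => /andP[/L1P[_ cu] /L2P[_]]; rewrite cu; by case: (c x).
(* A parent of [u] in [L1]; the default [x] never occurs for [u] in [L2]. *)
pose p u : T := odflt x [pick y in L1 | r y u].
have pP u : u \in L2 -> p u \in L1 /\ r (p u) u.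
  rewrite inE => /and3P[_ _ /exists_inP[y yL ryu]]; rewrite /p.
  by case: pickP => [z /andP[]//|/(_ y)]; rewrite yL ryu.
(* A path of length 4 with both ends in [L1] would close through [x]. *)
have e12 : \sum_(y in L1) deg r L2 y <= 2 * (#|L1| + #|L2|).
  rewrite leqNgt; apply/negP => /(zigzag d12).
  case=> [a0 [b1 [a2 [b3 [a4 [[a0L b1L a2L b3L a4L] [r1 r2 r3 r4] ua nb]]]]]].
  have [[x0 c0] [x2 c2] [x4 c4]] := And3 (L1P _ a0L) (L1P _ a2L) (L1P _ a4L).
  have [[n1 c1] [n3 c3]] := (L2P _ b1L, L2P _ b3L).
  apply: (nohex x a0 b1 a2 b3 a4) => //.
    by rewrite /= x0 r1 r2 r3 r4 rsym x4.
  by rewrite /= !inE negb_or ![x == _]eq_sym n1 n3 nb.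
(* Otherwise [x], [p u], [u], [w], [u'], [p u'] is a hexagon. So [w] has a well-defined grandparent,
   [q w] below. *)
have same w u u' : w \in L3 -> u \in L2 -> u' \in L2 -> r u w -> r u' w -> p u = p u'.
  move=> wL uL u'L ruw ru'w; apply/eqP; apply: contraT => npp.
  have [[pL rpu] [p'L rpu']] := (pP _ uL, pP _ u'L).
  have [[xp cp] [xp' cp']] := (L1P _ pL, L1P _ p'L).
  have [[nu cu] [nu' cu']] := (L2P _ uL, L2P _ u'L).
  have [nw cw] := L3P _ wL.
  have : False; last by [].
  apply: (nohex x (p u) u w u' (p u')).
  - by rewrite /= xp rpu ruw rsym ru'w rsym rpu' rsym xp'.
  - rewrite /= !inE negb_or ![x == _]eq_sym nu nu' /= andbT.
    by apply: contra npp => /eqP->.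
  - rewrite /= !inE negb_or npp !andbT.
    by rewrite [w == _]eq_sym !(contraNneq _ nw) // => <-.
pose q w : T := odflt x (omap p [pick u in L2 | r u w]).
have qP w u : w \in L3 -> u \in L2 -> r u w -> q w = p u.
  move=> wL uL ruw; rewrite /q; case: pickP => [v /andP[vL rvw]|/(_ u)] /=.
    exact: (same w).
  by rewrite uL ruw.
have qL w : w \in L3 -> q w \in L1.
  move=> wL; have := wL; rewrite inE => /and3P[_ _ /exists_inP[u uL ruw]].
  by rewrite (qP w u) //; have [] := pP u uL.
pose A y := [set u in L2 | p u == y].
pose B y := [set w in L3 | q w == y].
(* Here a path of length 4 with both ends among the children of [y] closes through [y]. *)
have eAB y : y \in L1 -> \sum_(u in A y) deg r (B y) u <= 2 * (#|A y| + #|B y|).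
  move=> yL; rewrite leqNgt; apply/negP => /zigzag[].
    rewrite -setI_eq0; apply/eqP/setP => u; rewrite in_set0 in_setI.
    apply/negP => /andP[]; rewrite in_set => /andP[/L2P[_ cu] _].
    rewrite in_set => /andP[/L3P[_]]; rewrite cu; by case: (c x).
  move=> a0 [b1 [a2 [b3 [a4 [[a0A b1B a2A b3B a4A] [r1 r2 r3 r4] ua nb]]]]].
  have AP u : u \in A y -> u \in L2 /\ r y u.
    by rewrite inE => /andP[uL /eqP<-]; split=> //; have [] := pP u uL.
  have BP w : w \in B y -> y != w.
    rewrite inE => /andP[/L3P[wL _] _]; by apply: contraNneq wL => <-.
  have [_ y0] := AP _ a0A; have [_ y4] := AP _ a4A.
  apply: (nohex y a0 b1 a2 b3 a4) => //.
    by rewrite /= y0 r1 r2 r3 r4 rsym y4.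
  by rewrite /= !inE negb_or !BP ?nb.
(* An edge from [L2] to [L3] joins [A y] to [B y] for a single [y], so the bounds [eAB] add up. *)
have e23 : \sum_(u in L2) deg r L3 u <= 2 * (#|L2| + #|L3|).
  rewrite (partition_big p (mem L1)) /=; last by move=> u /pP[].
  have -> : #|L2| = \sum_(y in L1) #|A y|.
    rewrite -sum1_card (partition_big p (mem L1)) /=; last by move=> u /pP[].
    by apply: eq_bigr => y _; rewrite -sum1_card; apply: eq_bigl => u; rewrite !inE.
  have -> : #|L3| = \sum_(y in L1) #|B y|.
    rewrite -sum1_card (partition_big q (mem L1)) /=; last by move=> u /qL.
    by apply: eq_bigr => y _; rewrite -sum1_card; apply: eq_bigl => u; rewrite !inE.
  rewrite -big_split big_distrr /=; apply: leq_sum => y yL.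
  apply: leq_trans (eAB y yL); rewrite [X in X <= _](eq_bigl (mem (A y))); last first.
    by move=> u; rewrite !inE.
  apply: leq_sum => u uA; apply/subset_leq_card/subsetP => w.
  rewrite /nbr in_set => /andP[wL ruw]; rewrite in_set ruw andbT in_set wL /=.
  have : u \in A y by []. rewrite in_set => /andP[uL /eqP<-]; by rewrite (qP w u).
(* The only neighbour of [y] that may be lost is [x]; all others lie in [L2]. *)
have degL1 : D.-1 * #|L1| <= \sum_(y in L1) deg r L2 y.
  rewrite mulnC -sum_nat_const; apply: leq_sum => y yL.
  have [rxy cy] := L1P y yL; have yS : y \in S by exact: rS rxy.
  apply: (@leq_trans #|nbr r S y :\ x|).
    by have := degS yS; rewrite /deg (cardsD1 x); lia.
  apply/subset_leq_card/subsetP => u; rewrite !inE => /and3P[ux uS ryu].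
  rewrite uS ux ryu andbT /=; by apply/exists_inP; exists y.
have degL2 : D * #|L2| <= \sum_(u in L2) deg r L1 u + \sum_(u in L2) deg r L3 u.
  rewrite mulnC -sum_nat_const -big_split; apply: leq_sum => u uL /=.
  have uS : u \in S by move: uL; rewrite inE => /andP[].
  apply: leq_trans (degS uS) _; rewrite (deg_setID r L1) leq_add //.
    by apply: deg_sub; apply: subsetIr.
  apply/subset_leq_card/subsetP => w; rewrite /nbr in_set in_setD => /andP[/andP[wL wS] ruw].
  rewrite in_set ruw andbT in_set wS wL; by apply/exists_inP; exists u.
have L1D : D <= #|L1| by exact: degS.
have leS : #|L3| <= #|S|.
  by apply/subset_leq_card/subsetP => u; rewrite inE => /andP[].
have ex12 := exchange_deg L1 L2 rsym.
(* Since [12 <= D], the lower-order multiples of [#|L1|] and [#|L2|] are absorbed by the left sides,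
   which leaves a growth factor [D / 4] per level. *)
have le12 n := leq_mul D12 (leqnn n).
have {}degL1 : D * #|L1| <= 3 * #|L1| + 2 * #|L2|.
  by move: degL1 (le12 #|L1|) e12; rewrite -subn1 mulnBl; lia.
have {}degL2 : D * #|L2| <= 4 * #|L3|.
  by move: degL2 (le12 #|L1|) (le12 #|L2|) e12 e23; lia.
have {}degL1 : D * #|L1| <= 4 * #|L2| by move: (le12 #|L1|); lia.
have b3 : D * (D * #|L1|) <= D * (4 * #|L2|) by rewrite leq_mul2l degL1 orbT.
have b4 : D * (D * D) <= D * (D * #|L1|) by rewrite !leq_mul2l L1D !orbT.
move: ltS; rewrite !expnS expn0 muln1; lia.
Qed.

End Hexagon.

(** * Copies of the pyramid *)

Definition rel_of (T : finType) (G : {set {set T}}) : rel T :=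
  fun x y => [set x; y] \in G.

Lemma rel_of_sym (T : finType) (G : {set {set T}}) : symmetric (rel_of G).
Proof. by move=> x y; rewrite /rel_of setUC. Qed.

Lemma rel_of_irr (T : finType) (G : {set {set T}}) :
  simple_graph G -> irreflexive (rel_of G).
Proof.
move=> /forall_inP sG x; apply/negP => /sG; by rewrite setUid cards1.
Qed.

Lemma degsum_edges (T : finType) (G : {set {set T}}) :
  simple_graph G -> degsum (rel_of G) setT = 2 * #|G|.
Proof.
move=> sG; have irr := rel_of_irr sG; move: sG => /forall_inP sG.
have -> : 2 * #|G| = \sum_(E in G) \sum_(x in setT) (x \in E).
  rewrite mulnC -sum_nat_const; apply: eq_bigr => E EG.
  rewrite -big_mkcondr /= -(eqP (sG E EG)) -sum1_card.
  by apply: eq_bigl => x; rewrite inE.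
rewrite exchange_big; apply: eq_bigr => x _ /=.
rewrite -big_mkcondr sum1_card /=.
have inj : {in nbr (rel_of G) setT x &, injective (fun y => [set x; y])}.
  move=> y z; rewrite !inE /= => xy xz eqyz.
  have : y \in [set x; z] by rewrite -eqyz !inE eqxx orbT.
  rewrite !inE => /orP[/eqP yx|/eqP//].
  by move: xy; rewrite yx irr.
rewrite /deg -(card_in_imset inj); apply: eq_card => E.
rewrite unfold_in /=; apply/imsetP/andP => [[y]|[EG xE]].
  by rewrite !inE /= => xy ->; rewrite !inE eqxx.
have /cards2P[a [b [ab eqE]]] := sG E EG.
move: xE EG; rewrite eqE !inE => /orP[]/eqP-> EG.
  by exists b; rewrite ?inE.
by exists a; rewrite ?inE /rel_of setUC.
Qed.

(** Rank of place [j] in layer [i] when the pyramid is listed layer by layer; the offsets are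
    triangular numbers. *)
Definition tp_index (i j : nat) : nat := nth 0 [:: 0; 1; 3; 6; 10] i + j.

Lemma contains_TP4 (T : finType) (G : {set {set T}}) (x0 : T) (s : seq T) :
  size s = 15 -> uniq s ->
  (forall i j, j < i <= 4 ->
     rel_of G (nth x0 s (tp_index i j)) (nth x0 s (tp_index i j.+1))) ->
  (forall i j, j <= i < 4 ->
     rel_of G (nth x0 s (tp_index i j)) (nth x0 s (tp_index i.+1 j)) &&
     rel_of G (nth x0 s (tp_index i j)) (nth x0 s (tp_index i.+1 j.+1))) ->
  contains_copy (TP 4) G.
Proof.
move=> sz us horiz down.
pose f := [ffun x : TP_vertex 4 => nth x0 s (tp_index (layer x) (pos x))].
have bnd (x : TP_vertex 4) : layer x <= 4 /\ pos x <= layer x.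
  by split; rewrite -ltnS ltn_ord.
(* Inverse table of [tp_index], from which [f] is injective. *)
pose inv k := nth (0, 0) [:: (0, 0); (1, 0); (1, 1); (2, 0); (2, 1); (2, 2);
  (3, 0); (3, 1); (3, 2); (3, 3); (4, 0); (4, 1); (4, 2); (4, 3); (4, 4)] k.
have invK i j : i <= 4 -> j <= i ->
    tp_index i j < size s /\ inv (tp_index i j) = (i, j).
  rewrite sz; move: i => [|[|[|[|[|i]]]]] // _;
  by move: j => [|[|[|[|[|j]]]]].
apply/existsP; exists f; apply/andP; split.
  apply/injectiveP => x y; rewrite !ffunE.
  have [lx px] := bnd x; have [ly py] := bnd y.
  have [[ix kx] [iy ky]] := (invK _ _ lx px, invK _ _ ly py).
  move/eqP; rewrite nth_uniq // => /eqP eqi.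
  have [el ep] : (layer x, pos x) = (layer y, pos y) by rewrite -kx eqi ky.
  case: x y el ep {lx px ly py eqi ix kx iy ky} => [i j] [i' j']; rewrite /layer /pos /=.
  move/val_inj => ii'; move: j'; rewrite -ii' => j' /val_inj -> //.
apply/forall_inP => E /imset2P[x y _]; rewrite inE => /andP[_ arc] ->.
rewrite imsetU !imset_set1 !ffunE -/(rel_of G _ _).
have [lx px] := bnd x; have [ly py] := bnd y.
case/orP: arc => /andP[/eqP el].
  by move=> /eqP ep; rewrite el ep; apply: horiz; lia.
have dn : pos x <= layer x < 4 by lia.
by case/orP=> /eqP ep; rewrite el ep; case/andP: (down _ _ dn).
Qed.

(* The class of the central vertex in the 3-colouring of [TP 4] is complementary
   to a hexagon with paths of length 2 hanging from two adjacent vertices. *)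
Lemma contains_TP4_of_hexagon (T : finType) (G : {set {set T}})
    (h0 h1 h2 h3 h4 h5 p0 p1 q0 q1 : T) (A : {set T}) :
  let H := [:: h0; h1; h2; h3; h4; h5; p0; p1; q0; q1] in
  irreflexive (rel_of G) ->
  uniq H -> cycle (rel_of G) [:: h0; h1; h2; h3; h4; h5] ->
  path (rel_of G) h4 [:: p0; p1] -> path (rel_of G) h3 [:: q0; q1] ->
  4 < #|A| -> (forall a, a \in A -> all (rel_of G a) H) ->
  contains_copy (TP 4) G.
Proof.
move=> H irr uH; rewrite /= !andbT => cH pH qH /card_geqP[a [ua sa aA]] aH.
have {aA}aH b : b \in a -> all (rel_of G b) H by move/aA/aH.
have disj b : b \in a -> b \notin H.
  by move=> /aH/allP bH; apply/negP => /bH; rewrite irr.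
case: a sa ua aH disj => [|a0 [|a1 [|a2 [|a3 [|a4 [|//]]]]]] // _ ua aH disj.
have [] := And5 (aH a0 _) (aH a1 _) (aH a2 _) (aH a3 _) (aH a4 _); rewrite ?inE ?eqxx ?orbT //.
rewrite /H /= !andbT => A0 A1 A2 A3 A4.
(* The layers are a0; h0 h1; h5 a1 h2; a2 h4 h3 a3; p1 p0 a4 q0 q1. The hexagon surrounds [a1], and
   the paths start at the bottom neighbours [h4] and [h3] of [a1]. *)
pose s := [:: a0; h0; h1; h5; a1; h2; a2; h4; h3; a3; p1; p0; a4; q0; q1].
have sym := rel_of_sym G.
apply: (@contains_TP4 T G a0 s) => //.
- pose t := [:: a0; a1; a2; a3; a4] ++ H.
  have ut : uniq t.
    rewrite cat_uniq ua uH andbT; apply/hasPn => x xH; apply/negP => /disj.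
    by rewrite xH.
  pose l := [:: 0; 5; 6; 10; 1; 7; 2; 9; 8; 3; 12; 11; 4; 13; 14].
  have ltl i : i \in l -> i < size t.
    by apply/allP: i.
  rewrite -[s]/[seq nth a0 t i | i <- l] map_inj_in_uniq // => i j il jl /eqP.
  by rewrite nth_uniq ?ltl // => /eqP.
- move=> i j bij; move: A0 A1 A2 A3 A4 cH pH qH; do ![case/andP || move=> ?].
  move: i j bij => i j; move: i => [|[|[|[|[|i]]]]]; rewrite ?ltnS ?ltn0 ?andbF //;
  move: j => [|[|[|[|j]]]]; rewrite ?ltnS ?ltn0 ?andbF //= => _; rewrite /tp_index /s /=;
  first [assumption | rewrite sym; assumption].
- move=> i j bij; move: A0 A1 A2 A3 A4 cH pH qH; do ![case/andP || move=> ?].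
  move: i j bij => i j; move: i => [|[|[|[|i]]]]; rewrite ?ltnS ?ltn0 ?andbF //;
  move: j => [|[|[|[|j]]]]; rewrite ?ltnS ?ltn0 ?andbF //= => _; rewrite /tp_index /s /=;
  apply/andP; split; first [assumption | rewrite sym; assumption].
Qed.

(** * Dense neighbourhoods give complete tripartite subgraphs *)

Lemma subset_of_card (T : finType) (A : {set T}) m :
  m <= #|A| -> exists2 B : {set T}, B \subset A & #|B| = m.
Proof.
case/card_geqP => s [us <- sA]; exists [set x in s].
  by apply/subsetP => x; rewrite inE => /sA.
by rewrite cardsE; apply/card_uniqP.
Qed.

(** Double counting and pigeonhole. Points lying in fewer than [t] of the sets carry at most half of
    the guaranteed incidences, so a fraction [1 / (2 * a)] of [V] lies in at least [t] sets. Sorting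
    these points by the exact family of sets containing them gives at most [2 ^ #|J|] classes, and
    one of them is large. *)
Lemma common_intersection (I U : finType) (J : {set I}) (V : {set U})
    (A : I -> {set U}) a t :
  0 < #|V| -> 0 < #|J| -> 2 * a * t <= #|J| ->
  (forall i, i \in J -> A i \subset V /\ #|V| <= a * #|A i|) ->
  exists S : {set I}, exists Z : {set U},
    [/\ S \subset J, t <= #|S|, Z \subset V, forall i, i \in S -> Z \subset A i &
        #|V| <= 2 * a * 2 ^ #|J| * #|Z|].
Proof.
move=> V0 J0 Jt AV.
pose phi u := [set i in J | u \in A i].
(* The points with index set exactly [S]; no points if [S] has fewer than [t] elements. *)
pose fib S := [set u in V | (t <= #|phi u|) && (phi u == S)].
have [/existsP[S /and3P[SJ St leZ]]|none] :=
  boolP [exists S : {set I}, [&& S \subset J, t <= #|S| &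
           #|V| <= 2 * a * 2 ^ #|J| * #|fib S|]].
  exists S, (fib S); split=> //; first by apply/subsetP => u; rewrite inE => /andP[].
  move=> i iS; apply/subsetP => u; rewrite inE => /and3P[_ _ /eqP phiS].
  by move: iS; rewrite -phiS inE => /andP[].
pose R := [set u in V | t <= #|phi u|].
have sumphi : \sum_(u in V) #|phi u| = \sum_(i in J) #|A i|.
  transitivity (\sum_(u in V) \sum_(i in J) (u \in A i)).
    apply: eq_bigr => u _; rewrite -big_mkcondr -sum1_card /=.
    by apply: eq_bigl => i; rewrite inE.
  rewrite exchange_big; apply: eq_bigr => i iJ.
  rewrite -big_mkcondr -sum1_card /=; apply: eq_bigl => u.
  by apply: andb_idl; move/subsetP: (proj1 (AV i iJ)); apply.
have leJ : #|J| * #|V| <= a * \sum_(u in V) #|phi u|.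
  by rewrite sumphi big_distrr -sum_nat_const; apply: leq_sum => i /AV[].
have leR : \sum_(u in V) #|phi u| <= #|R| * #|J| + #|V| * t.
  rewrite (big_setID R) /= leq_add //.
    apply: leq_trans (_ : #|V :&: R| * #|J| <= _); last first.
      by rewrite leq_mul2r subset_leq_card ?orbT ?subsetIr.
    rewrite -sum_nat_const; apply: leq_sum => u _; apply/subset_leq_card/subsetP => i.
    by rewrite inE => /andP[].
  apply: leq_trans (_ : #|V :\: R| * t <= _); last first.
    by rewrite leq_mul2r subset_leq_card ?orbT ?subsetDl.
  rewrite -sum_nat_const; apply: leq_sum => u.
  by rewrite !inE => /andP[+ uV]; rewrite uV -ltnNge => /ltnW.
have leVR : #|V| <= 2 * a * #|R|.
  rewrite -(leq_pmul2l J0).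
  have : a * \sum_(u in V) #|phi u| <= a * (#|R| * #|J| + #|V| * t).
    by rewrite leq_mul2l leR orbT.
  have : 2 * a * t * #|V| <= #|J| * #|V| by rewrite leq_mul2r Jt orbT.
  move: leJ; lia.
have cardR : #|R| = \sum_(S in powerset J) #|fib S|.
  rewrite -sum1_card (partition_big phi (mem (powerset J))) /=; last first.
    by move=> u _; rewrite inE; apply/subsetP => i; rewrite inE => /andP[].
  apply: eq_bigr => S _; rewrite -sum1_card; apply: eq_bigl => u.
  by rewrite !inE andbA.
have small S : S \in powerset J -> 2 * a * 2 ^ #|J| * #|fib S| < #|V|.
  rewrite inE => SJ; have [St|St] := leqP t #|S|.
    by move/existsPn: none => /(_ S); rewrite SJ St -ltnNge.
  suff -> : fib S = set0 by rewrite cards0 muln0.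
  apply/setP => u; rewrite !inE; apply/negP => /and3P[_ + /eqP phiS].
  by rewrite phiS leqNgt St.
have : 2 * a * 2 ^ #|J| * #|R| < 2 ^ #|J| * #|V|.
  rewrite cardR big_distrr /= -card_powerset -sum_nat_const.
  rewrite (big_setD1 set0) ?inE ?sub0set //= [X in _ < X](big_setD1 set0) ?inE ?sub0set //=.
  rewrite -addSn leq_add //.
    by rewrite card_powerset; apply: small; rewrite inE sub0set.
  apply: leq_sum => S; rewrite in_setD => /andP[_ SJ].
  by rewrite card_powerset; apply/ltnW/small.
have : 2 ^ #|J| * #|V| <= 2 ^ #|J| * (2 * a * #|R|) by rewrite leq_mul2l leVR orbT.
lia.
Qed.

Section Dense.
Variables (T : finType) (e : rel T).

(** The complete tripartite graph with parts of size [t]; for irreflexive [e] the parts are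
    automatically disjoint. *)
Definition contains_K (t : nat) : Prop := exists X Y Z : {set T},
  [/\ [/\ t <= #|X|, t <= #|Y| & t <= #|Z|],
      {in X & Y, forall x y, e x y}, {in X & Z, forall x z, e x z} &
      {in Y & Z, forall y z, e y z}].

(** Ordered pairs completing [x] to a triangle, kept as a subset of [V] times [V] so that the
    intersection lemma applies to links. *)
Definition link (V : {set T}) (x : T) : {set T * T} :=
  [set p in setX V V | [&& e x p.1, e x p.2 & e p.1 p.2]].

Lemma card_link V x : #|link V x| = degsum e (nbr e V x).
Proof.
rewrite -sum1_card /degsum (eq_bigr (fun y => \sum_(z in nbr e V x | e y z) 1)).
  rewrite pair_big_dep /=; apply: eq_bigl => -[y z].
  by rewrite !inE /=; case: (y \in V); case: (z \in V); case: (e x y); case: (e x z).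
by move=> y _; rewrite degE big_mkcondr.
Qed.
End Dense.

(** The intersection lemma is used twice. Applied to dense links, it gives vertices [S] sharing a
    dense set [P] of pairs; applied to the dense rows of [P], it gives [S'] and [Z] with all pairs
    between them in [P]. Then [S], [S'], [Z] are the three parts. *)
Lemma dense_links (a t : nat) : 0 < t ->
  exists m b, forall (T : finType) (e : rel T) (V : {set T}),
  b <= #|V| -> m <= #|[set x in V | #|V| ^ 2 <= a * #|link e V x|]| ->
  contains_K e t.
Proof.
(* [m] and [m'] are the family sizes needed in the two applications; [c] and [d] are the inverse
   densities obtained for [P] and [Z]. Each is kept as a variable with an equation. *)
move=> t0; have [m mE] : {m | m = (2 * a * t).+1} by exists (2 * a * t).+1.
have [c cE] : {c | c = 2 * a * 2 ^ m} by exists (2 * a * 2 ^ m).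
have [m' m'E] : {m' | m' = (2 * (2 * c) * t).+1} by exists (2 * (2 * c) * t).+1.
have [d dE] : {d | d = 2 * (2 * c) * 2 ^ m'} by exists (2 * (2 * c) * 2 ^ m').
exists m, (2 * c * m' + d * t).+1 => T e V bV /subset_of_card[J JV cJ].
have V0 : 0 < #|V| by apply: leq_trans bV.
have VV : #|setX V V| = #|V| ^ 2 by rewrite cardsX.
have [||||S [P [SJ St PV PS leP]]] := @common_intersection _ _ J (setX V V) (link e V) a t.
- by rewrite VV expn_gt0 V0.
- by rewrite cJ mE.
- by rewrite cJ mE leqnSn.
- move=> x /(subsetP JV); rewrite inE VV => /andP[_ ->]; split=> //.
  by apply/subsetP => p; rewrite inE => /andP[].
rewrite VV cJ -cE in leP.
pose row y := [set z in V | (y, z) \in P].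
pose Y := [set y in V | #|V| <= 2 * c * #|row y|].
have cardP : #|P| = \sum_(y in V) #|row y|.
  rewrite -sum1_card (eq_bigr (fun y => \sum_(z in V | (y, z) \in P) 1)).
    rewrite pair_big_dep /=; apply: eq_bigl => -[y z] /=.
    apply/idP/idP => [yzP|/and3P[]//]; rewrite yzP andbT.
    by move/subsetP: PV => /(_ _ yzP); rewrite inE.
  by move=> y _; rewrite sum1_card; apply: eq_card => z; rewrite !inE.
(* Rows outside [Y] hold at most half of [P]. *)
have leY : #|V| <= 2 * c * #|Y|.
  have : 2 * c * #|P| <= 2 * c * #|Y| * #|V| + #|V| * #|V|.
    rewrite cardP (big_setID Y) /= mulnDr leq_add // big_distrr /=.
      apply: leq_trans (_ : \sum_(y in V :&: Y) 2 * c * #|V| <= _).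
        apply: leq_sum => y _; rewrite leq_mul2l.
        by rewrite (subset_leq_card (B := V)) ?orbT //; apply/subsetP => z; rewrite inE => /andP[].
      rewrite sum_nat_const.
      have : #|V :&: Y| <= #|Y| by rewrite subset_leq_card ?subsetIr.
      move=> leA; rewrite mulnC [X in _ <= X]mulnAC; exact: leq_mul.
    apply: leq_trans (_ : \sum_(y in V :\: Y) #|V| <= _).
      apply: leq_sum => y; rewrite !inE => /andP[+ yV].
      by rewrite yV /= -ltnNge => /ltnW.
    by rewrite sum_nat_const leq_mul2r subset_leq_card ?orbT ?subsetDl.
  move=> le2; rewrite -(leq_pmul2r V0); move: le2 leP; rewrite expnS expn1; lia.
have c0 : 0 < 2 * c.
  by case: (posnP (2 * c)) leY => // ->; rewrite mul0n leqNgt V0.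
have /subset_of_card[J' J'Y cJ'] : m' <= #|Y|.
  rewrite -(leq_pmul2l c0); apply: leq_trans leY; apply: leq_trans bV; lia.
have [||||S' [Z [S'J' S't ZV ZS leZ]]] := @common_intersection _ _ J' V row (2 * c) t.
- by [].
- by rewrite cJ' m'E.
- by rewrite cJ' m'E leqnSn.
- move=> y /(subsetP J'Y); rewrite inE => /andP[_ ->]; split=> //.
  by apply/subsetP => z; rewrite inE => /andP[].
have rowP y z : y \in S' -> z \in Z -> (y, z) \in P.
  by move=> yS' zZ; move/subsetP: (ZS y yS') => /(_ z zZ); rewrite inE => /andP[].
have t_Z : t <= #|Z|.
  rewrite cJ' -dE in leZ.
  have k0 : 0 < d by rewrite dE 2!muln_gt0 c0 expn_gt0.
  rewrite -(leq_pmul2l k0); apply: leq_trans leZ; apply: leq_trans bV; lia.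
have [[y0 y0S'] [z0 z0Z]] : (exists y, y \in S') * (exists z, z \in Z).
  by split; apply/set0Pn; rewrite -card_gt0; apply: leq_trans t0 _.
exists S, S', Z; split=> //.
- move=> x y xS yS'; move/subsetP: (PS x xS) => /(_ _ (rowP y z0 yS' z0Z)).
  by rewrite inE => /and4P[].
- move=> x z xS zZ; move/subsetP: (PS x xS) => /(_ _ (rowP y0 z y0S' zZ)).
  by rewrite inE => /and4P[].
have /set0Pn[x xS] : S != set0 by rewrite -card_gt0; apply: leq_trans t0 _.
move=> y z yS' zZ; move/subsetP: (PS x xS) => /(_ _ (rowP y z yS' zZ)).
by rewrite inE => /and4P[].
Qed.

(** * The bipartition *)

(** The hexagon and its two paths alternate between [Y] and [Z], using five vertices of each, and
    [X] supplies the common neighbours. *)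
Lemma contains_TP4_of_K5 (T : finType) (G : {set {set T}}) :
  irreflexive (rel_of G) -> contains_K (rel_of G) 5 -> contains_copy (TP 4) G.
Proof.
move=> irr [X [Y [Z [[X5 /card_geqP[y [uy sy yY]] /card_geqP[z [uz sz zZ]]] XY XZ YZ]]]].
have {}YZ u v : u \in y -> v \in z -> rel_of G u v by move=> /yY uY /zZ; apply: YZ.
have {}XY x u : x \in X -> u \in y -> rel_of G x u by move=> xX /yY; apply: XY.
have {}XZ x u : x \in X -> u \in z -> rel_of G x u by move=> xX /zZ; apply: XZ.
have yz u v : u \in y -> v \in z -> u != v.
  by move=> uy' vz; apply: contraTneq (YZ _ _ uy' vz) => ->; rewrite irr.
have sym := rel_of_sym G.
have ZY u v : v \in z -> u \in y -> rel_of G v u by rewrite sym => vz uy'; apply: YZ.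
case: y sy uy YZ XY yz ZY {yY} => [|y0 [|y1 [|y2 [|y3 [|y4 [|//]]]]]] // _ uy YZ XY yz ZY.
case: z sz uz YZ XZ yz ZY {zZ} => [|z0 [|z1 [|z2 [|z3 [|z4 [|//]]]]]] // _ uz YZ XZ yz ZY.
apply: (@contains_TP4_of_hexagon T G y0 z0 y1 z1 y2 z2 z3 y3 y4 z4 X) => //.
- pose t := [:: y0; y1; y2; y3; y4; z0; z1; z2; z3; z4].
  have ut : uniq t.
    rewrite -[t]/([:: y0; y1; y2; y3; y4] ++ [:: z0; z1; z2; z3; z4]) cat_uniq uy uz andbT.
    by apply/hasPn => v vz; apply/negP => vy; have := yz v v vy vz; rewrite eqxx.
  pose l := [:: 0; 5; 1; 6; 2; 7; 8; 3; 4; 9].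
  have ltl i : i \in l -> i < size t by apply/allP: i.
  rewrite -[X in uniq X]/[seq nth y0 t i | i <- l] map_inj_in_uniq // => i j il jl /eqP.
  by rewrite nth_uniq ?ltl // => /eqP.
- rewrite /= ?andbT; do ?[apply/andP; split];
  by [apply: YZ; rewrite !inE eqxx ?orbT | apply: ZY; rewrite !inE eqxx ?orbT].
- rewrite /= ?andbT; do ?[apply/andP; split];
  by [apply: YZ; rewrite !inE eqxx ?orbT | apply: ZY; rewrite !inE eqxx ?orbT].
- rewrite /= ?andbT; do ?[apply/andP; split];
  by [apply: YZ; rewrite !inE eqxx ?orbT | apply: ZY; rewrite !inE eqxx ?orbT].
- move=> x xX; rewrite /= ?andbT; do ?[apply/andP; split];
  by [apply: XY; rewrite // !inE eqxx ?orbT | apply: XZ; rewrite // !inE eqxx ?orbT].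
Qed.

Lemma setU_setD (T : finType) (A B : {set T}) : A \subset B -> A :|: (B :\: A) = B.
Proof. by move=> AB; rewrite -[X in X :|: _](setIidPr AB) setID. Qed.

Lemma disjoint_setD (T : finType) (A B : {set T}) : [disjoint A & B :\: A].
Proof.
by rewrite -setI_eq0; apply/eqP/setP => x; rewrite !inE; case: (x \in A).
Qed.

Section Bipartition.
Variables (T : finType) (e : rel T) (V : {set T}) (m : nat).
Let N := #|V|.
(** The exceptional vertices, whose neighbourhoods span quadratically many edges. *)
Let W := [set x in V | N ^ 2 <= 20 * 1000 * #|link e V x|].
Hypothesis degV : forall x, x \in V -> N <= 2 * deg e V x.
Hypothesis W_le : #|W| <= m.
Hypothesis N_gt : 4 * m < N.

(** [A0] is the neighbourhood of some [x] outside [W], hence sparse. A typical [y] in [A0] has few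
    neighbours in [A0], so by the degree condition it sees almost all of [B0]; thus [B0] nearly lies
    in the sparse neighbourhood of [y]. *)
Lemma sparse_pair : exists A0 B0 : {set T},
  [/\ A0 :|: B0 = V, [disjoint A0 & B0], 2 * #|B0| <= N,
      20 * 1000 * degsum e A0 <= N ^ 2 & 400 * degsum e B0 <= N ^ 2].
Proof.
have VWP v : v \in V -> v \notin W -> 20 * 1000 * degsum e (nbr e V v) < N ^ 2.
  by move=> vV; rewrite inE vV -ltnNge /= card_link.
have [x xVW] : exists x, x \in V :\: W.
  by apply/set0Pn; rewrite -card_gt0 cardsD; have := subset_leq_card (subsetIr V W); lia.
move: xVW; rewrite in_setD => /andP[xW xV].
pose A0 := nbr e V x; pose B0 := V :\: A0.
have A0V : A0 \subset V by apply: nbr_sub.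
have cA0 : N <= 2 * #|A0| by exact: degV.
have cAB : #|A0| + #|B0| = N by rewrite /N -(cardsID A0 V) (setIidPr A0V).
have sA0 := VWP x xV xW; rewrite -/A0 in sA0.
pose A1 := [set y in A0 | N <= 800 * deg e A0 y].
have leA1 : 20 * 1000 * #|A1| <= 800 * N.
  have : #|A1| * N <= 800 * degsum e A0.
    rewrite -sum_nat_const /degsum (big_setID A1 (A := A0)) mulnDr big_distrr /=.
    apply: leq_trans (leq_addr _ _).
    rewrite (setIidPr _); last by apply/subsetP => y; rewrite inE => /andP[].
    by apply: leq_sum => y; rewrite inE => /andP[].
  move=> leA; have N0 : 0 < N by lia.
  by rewrite -(leq_pmul2r N0); move: leA sA0; rewrite expnS expn1; lia.
(* [A0] has at least [N / 2] vertices, [A1] at most [N / 25] and [W] at most [N / 4]. *)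
have [y] : exists y, y \in A0 :\: (A1 :|: W).
  apply/set0Pn; rewrite -card_gt0 cardsD.
  have := subset_leq_card (subsetIr A0 (A1 :|: W)); have := (leq_card_setU A1 W).1.
  rewrite -/N in leA1; move: leA1; lia.
rewrite in_setD in_setU negb_or => /andP[/andP[yA1 yW] yA0].
have yV := subsetP A0V y yA0.
have {}yA1 : 800 * deg e A0 y < N by move: yA1; rewrite inE yA0 -ltnNge.
exists A0, B0; split.
- exact: setU_setD.
- exact: disjoint_setD.
- lia.
- exact: ltnW.
have := degsum_setD e (nbr_sub e B0 y).
have cD : 800 * #|B0 :\: nbr e B0 y| <= N.
  rewrite cardsD (setIidPr (nbr_sub _ _ _)) -/(deg e B0 y).
  have := degV yV; rewrite (deg_setID e A0) (setIidPr A0V) -/B0; move: yA1; lia.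
have sB : degsum e (nbr e B0 y) <= degsum e (nbr e V y).
  apply: degsum_sub; apply/subsetP => z; rewrite !inE.
  by case/andP=> /andP[_ ->].
have cB : 2 * #|B0| <= N by lia.
have := leq_mul cD cB.
move: sB (VWP y yV yW); rewrite expnS expn1; lia.
Qed.

(** Vertices outside [W] are redistributed by their degree into [A0]. None has [N / 100] neighbours
    on both sides, and few change sides, so degrees inside the new parts stay small. *)
Lemma bipartition : exists A B : {set T},
  [/\ A :|: B = V :\: W, [disjoint A & B],
      forall x, x \in A -> 50 * deg e A x <= N &
      forall x, x \in B -> 50 * deg e B x <= N].
Proof.
have [A0 [B0 [ABV dAB cB0 sA0 sB0]]] := sparse_pair.
have degAB v : deg e V v = deg e A0 v + deg e B0 v by rewrite -ABV !degE sumU.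
have A0V : A0 \subset V by rewrite -ABV subsetUl.
have B0V : B0 \subset V by rewrite -ABV subsetUr.
have N0 : 0 < N by lia.
pose A := [set v in V :\: W | 100 * deg e A0 v < N].
pose B := (V :\: W) :\: A.
have AB : A :|: B = V :\: W.
  by apply/setU_setD/subsetP => v; rewrite inE => /andP[].
have BP v : v \in B -> 100 * deg e B0 v < N.
  rewrite !inE negb_and -leqNgt => /andP[/orP[/negPf->//|Av] /andP[+ vV]].
  rewrite vV /= -ltnNge card_link; apply: contraTT; rewrite -!leqNgt => Bv.
  pose P := nbr e A0 v; pose Q := nbr e B0 v.
  have PA0 : P \subset A0 by apply: nbr_sub.
  (* A vertex [y] of [P] misses at most [deg e A0 y] vertices of [B0]. If [P] and [Q] both had
     [N / 100] vertices, this would leave [N ^ 2 / 20000] pairs in the link of [v], against [v]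
     being outside [W]. *)
  have lePQ : #|P| * #|Q| <= degsum e (nbr e V v) + degsum e A0.
    rewrite /degsum (big_setID P (A := A0)) (setIidPr PA0) /=.
    rewrite [X in _ <= X + _](big_setID P) /= (setIidPr _); last first.
      by apply/subsetP => y; rewrite !inE => /andP[/(subsetP A0V)-> ->].
    apply: leq_trans (_ : \sum_(y in P) (deg e (nbr e V v) y + deg e A0 y) <= _); last first.
      by rewrite big_split /=; lia.
    rewrite -sum_nat_const; apply: leq_sum => y yP.
    have yA0 := subsetP PA0 y yP.
    have cQ : #|Q| <= deg e Q y + #|B0| - deg e B0 y.
      have := deg_cover e B0 Q y; have := cardsID Q B0.
      rewrite (setIidPr (nbr_sub _ _ _)) -/Q; lia.
    have leQ : deg e Q y <= deg e (nbr e V v) y.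
      by apply: deg_sub; apply/subsetP => z; rewrite !inE => /andP[/(subsetP B0V)-> ->].
    have := degV (subsetP A0V y yA0); rewrite degAB; lia.
  have := leq_mul Av Bv; rewrite -/(deg e A0 v) -/(deg e B0 v).
  rewrite -[deg e A0 v]/#|P| -[deg e B0 v]/#|Q|.
  move: lePQ sA0; rewrite expnS expn1; lia.
(* A vertex moved from [B0] to [A] has few neighbours in [A0], hence at least [N / 4] in [B0];
   sparsity of [B0] bounds the number of such vertices. *)
have leAA : #|A :\: A0| * N <= 4 * degsum e B0.
  apply: leq_trans (_ : \sum_(v in A :\: A0) 4 * deg e B0 v <= _).
    rewrite -sum_nat_const; apply: leq_sum => v; rewrite !inE => /and3P[_ /andP[_ vV] Av].
    by have := degV vV; rewrite degAB; lia.
  rewrite -big_distrr /degsum leq_mul2l /= [X in _ <= X](big_setID (A :\: A0)) /=.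
  rewrite (setIidPr _) ?leq_addr //; apply/subsetP => v.
  rewrite in_setD => /andP[/negPf vA0]; rewrite !inE => /andP[/andP[_ vV] _].
  by move: vV; rewrite -ABV inE vA0.
have leBB : #|B :\: B0| * N <= 4 * degsum e A0.
  apply: leq_trans (_ : \sum_(v in B :\: B0) 4 * deg e A0 v <= _).
    rewrite -sum_nat_const; apply: leq_sum => v; rewrite in_setD => /andP[_ vB].
    have vV : v \in V by move: vB; rewrite !inE => /and3P[].
    by have := degV vV; have := BP v vB; rewrite degAB; lia.
  rewrite -big_distrr /degsum leq_mul2l /= [X in _ <= X](big_setID (B :\: B0)) /=.
  rewrite (setIidPr _) ?leq_addr //; apply/subsetP => v.
  rewrite in_setD => /andP[/negPf vB0]; rewrite !inE => /and3P[_ _ vV].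
  by move: vV; rewrite -ABV inE vB0 orbF.
exists A, B; split=> //.
- exact: disjoint_setD.
- move=> v; rewrite inE => /andP[_ Av]; have := deg_cover e A A0 v.
  have : 100 * #|A :\: A0| <= N.
    by rewrite -(leq_pmul2r N0); move: leAA sB0; rewrite expnS expn1; lia.
  lia.
- move=> v vB; have Bv := BP v vB; have := deg_cover e B B0 v.
  have : 100 * #|B :\: B0| <= N.
    by rewrite -(leq_pmul2r N0); move: leBB sA0; rewrite expnS expn1; lia.
  lia.
Qed.

End Bipartition.

(** * The upper bound *)

Lemma common_nbrs (T : finType) (e : rel T) (A B : {set T}) c (s : seq T) :
  symmetric e -> {subset s <= A} -> (forall x, x \in A -> #|B| <= deg e B x + c) ->
  #|B| <= #|[set y in B | all (e y) s]| + size s * c.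
Proof.
move=> esym + degB; elim: s => [|x s IH] sA.
  by rewrite (eq_card (B := B)) ?leq_addr // => y; rewrite inE /= andbT.
have {}IH : #|B| <= #|[set y in B | all (e y) s]| + size s * c.
  by apply: IH => y ys; apply: sA; rewrite inE ys orbT.
have xB := degB x (sA x (mem_head _ _)).
rewrite -(cardsID (nbr e B x) [set y in B | all (e y) s]) in IH.
have le1 : #|[set y in B | all (e y) s] :\: nbr e B x| <= c.
  have le2 : #|B :\: nbr e B x| <= c.
    by rewrite cardsD (setIidPr (nbr_sub _ _ _)) -/(deg e B x); lia.
  apply: leq_trans le2; apply/subset_leq_card/setSD/subsetP => y.
  by rewrite inE => /andP[].
have le2 : #|[set y in B | all (e y) s] :&: nbr e B x| <= #|[set y in B | all (e y) (x :: s)]|.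
  apply/subset_leq_card/subsetP => y; rewrite !inE /= => /andP[/andP[-> ->]] /=.
  by rewrite esym => ->.
by move: le2; rewrite /= mulSn; lia.
Qed.

(** A cut keeps half of the edges in [A], and its core of minimum degree above [D] contains a
    hexagon, to which the two paths are attached greedily. The ten vertices each miss at most [c] of
    [B], which leaves five common neighbours. *)
Lemma contains_TP4_of_part (T : finType) (G : {set {set T}}) (A B : {set T}) (c D : nat) :
  irreflexive (rel_of G) ->
  (forall x, x \in A -> #|B| <= deg (rel_of G) B x + c) -> 10 * c + 5 <= #|B| ->
  12 <= D -> 16 * #|A| < D ^ 3 -> 4 * D * #|A| < degsum (rel_of G) A ->
  contains_copy (TP 4) G.
Proof.
set e := rel_of G => eirr degB c_le D12 D3 dense.
have esym : symmetric e := @rel_of_sym _ G.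
have common H : size H = 10 -> {subset H <= A} -> 4 < #|[set y in B | all (e y) H]|.
  by move=> H10 HA; have := common_nbrs esym HA degB; rewrite H10; lia.
have [X leX] := half_cut A esym eirr.
have [|A' [A'A /set0Pn[x xA'] degA']] :=
  @min_degree_core _ (cut e X) A D (cut_sym X esym) (@cut_irr _ e X).
  by lia.
pose r := [rel x y | [&& cut e X x y, x \in A' & y \in A']].
have rsym : symmetric r by move=> y z; rewrite /= (cut_sym X esym) [(y \in _) && _]andbC.
have degr u : u \in A' -> D <= deg r A' u.
  move=> uA'; apply: leq_trans (ltnW (degA' u uA')) _.
  apply/subset_leq_card/subsetP => y; rewrite !inE /= uA' => /andP[-> ->] //.
have [|||s s6 [us cs]] :=
  @hexagon_of_degree _ r rsym (fun u => u \in X) A' D x _ _ degr xA' D12.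
- by move=> u v /and3P[/andP[]].
- by move=> u v /and3P[].
- by apply: leq_ltn_trans D3; rewrite leq_mul2l subset_leq_card.
have re u v : r u v -> [/\ e u v, u \in A' & v \in A'] by move=> /and3P[/andP[]].
have ext u (l : seq T) : u \in A' -> size l <= 9 ->
    exists v, [/\ v \in A', e u v & v \notin l].
  move=> uA' l9; have [|v [vA' /re[euv _ _] vl]] := @pick_nbr _ r A' u l; last by exists v.
  by apply: leq_trans (degr u uA'); lia.
case: s s6 us cs => [|h0 [|h1 [|h2 [|h3 [|h4 [|h5 [|//]]]]]]] // _ us.
rewrite /= andbT => /and4P[/re[e0 h0A h1A] /re[e1 _ h2A] /re[e2 _ h3A]].
move=> /and3P[/re[e3 _ h4A] /re[e4 _ h5A] /re[e5 _ _]].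
have [p0 [p0A ep0 p0l]] := ext h4 [:: h0; h1; h2; h3; h4; h5] h4A isT.
have [p1 [p1A ep1 p1l]] := ext p0 [:: p0; h0; h1; h2; h3; h4; h5] p0A isT.
have [q0 [q0A eq0 q0l]] := ext h3 [:: p1; p0; h0; h1; h2; h3; h4; h5] h3A isT.
have [q1 [q1A eq1 q1l]] := ext q0 [:: q0; p1; p0; h0; h1; h2; h3; h4; h5] q0A isT.
pose H := [:: h0; h1; h2; h3; h4; h5; p0; p1; q0; q1].
have HA : {subset H <= A}.
  move=> y yH; apply: (subsetP A'A); move: yH; rewrite !inE.
  by do 9! [case/orP=> [/eqP->//|]]; move=> /eqP->.
apply: (@contains_TP4_of_hexagon T G h0 h1 h2 h3 h4 h5 p0 p1 q0 q1
         [set y in B | all (e y) H]) => //.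
- have perm : perm_eq [:: h0; h1; h2; h3; h4; h5; p0; p1; q0; q1]
     [:: q1, q0, p1, p0 & [:: h0; h1; h2; h3; h4; h5]].
    rewrite -[X in perm_eq X _]/([:: h0; h1; h2; h3; h4; h5] ++ [:: p0; p1; q0; q1]).
    rewrite perm_catC -[X in perm_eq _ X]/([:: q1; q0; p1; p0] ++ _) perm_cat2r.
    by rewrite -[X in perm_eq _ X]/(rev [:: p0; p1; q0; q1]) perm_sym perm_rev.
  by rewrite (perm_uniq perm) !cons_uniq q1l q0l p1l p0l.
- by rewrite /= -/e e0 e1 e2 e3 e4 e5.
- by rewrite /= -/e ep0 ep1.
- by rewrite /= -/e eq0 eq1.
- exact: common.
- by move=> a; rewrite inE => /andP[].
Qed.

(** A vertex of either part has at least [#|V| / 2 - #|V| / 50 - m] neighbours in the other. So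
    neither part exceeds [#|V| / 2] by more than [#|V| / 50 + m], and a vertex of [A] misses at most
    twice this much of [B]. *)
Lemma contains_TP4_of_bipartition (T : finType) (G : {set {set T}})
    (V W A B : {set T}) (m n s : nat) :
  irreflexive (rel_of G) ->
  (forall x, x \in V -> #|V| <= 2 * deg (rel_of G) V x) ->
  W \subset V -> #|W| <= m -> 300 * m + 200 <= #|V| ->
  A :|: B = V :\: W -> [disjoint A & B] ->
  (forall x, x \in A -> 50 * deg (rel_of G) A x <= #|V|) ->
  (forall x, x \in B -> 50 * deg (rel_of G) B x <= #|V|) ->
  #|V| <= n -> n <= s ^ 3 ->
  48 * s * #|V| < degsum (rel_of G) A ->
  contains_copy (TP 4) G.
Proof.
set e := rel_of G => eirr degV WV Wm V300 AB dAB dA dB Vn ns dense.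
have cAB : #|A| + #|B| <= #|V|.
  rewrite -cardsUI disjoint_setI0 // cards0 addn0 AB.
  by apply/subset_leq_card/subsetDl.
have split_deg x : x \in V -> #|V| <= 2 * (deg e A x + deg e B x + m).
  move=> xV; apply: leq_trans (degV x xV) _; rewrite leq_mul2l /=.
  rewrite (deg_setID e W) (setIidPr WV) -AB.
  have -> : deg e (A :|: B) x = deg e A x + deg e B x by rewrite !degE sumU.
  by have := deg_le_card e W x; rewrite -/e; lia.
have ABV x : x \in A :|: B -> x \in V by rewrite AB inE => /andP[].
have [a aA] : exists a, a \in A.
  by apply/set0Pn; apply: contraTneq dense => ->; rewrite /degsum big_set0.
have aV : a \in V by apply: ABV; rewrite inE aA.
have lowB := split_deg a aV; have := dA a aA => dAa.
have := deg_le_card e B a => dBa.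
have [b bB] : exists b, b \in B by apply/set0Pn; rewrite -card_gt0; lia.
have bV : b \in V by apply: ABV; rewrite inE bB orbT.
have lowA := split_deg b bV; have := dB b bB => dBb.
have := deg_le_card e A b => dAb.
have s0 : 0 < s by rewrite lt0n; apply: contraTneq ns => ->; rewrite exp0n; lia.
(* The [+ 1] pays for rounding. With [D = 12 * s] the density threshold [4 * D] is [48 * s], and
   [D ^ 3] exceeds [16 * n]. *)
apply: (@contains_TP4_of_part T G A B (#|V| %/ 25 + 2 * m + 1) (12 * s)) => //.
- move=> x xA; have xV : x \in V by apply: ABV; rewrite inE xA.
  by have := split_deg x xV; have := dA x xA; rewrite -/e; lia.
- lia.
- lia.
- rewrite expnMn; lia.
- by apply: leq_ltn_trans dense; rewrite mulnA leq_mul2l; lia.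
Qed.

(** The integer [s] stands for a cube root of [n] rounded up, so the error term is of order
    [n ^ (4/3)]. *)
Lemma TP4_free_edges : exists C : nat, forall (n s : nat) (G : {set {set 'I_n}}),
  0 < n -> n <= s ^ 3 -> simple_graph G -> ~~ contains_copy (TP 4) G ->
  4 * #|G| <= n ^ 2 + C * n * s.
Proof.
have [m [b dense]] := @dense_links (20 * 1000) 5 isT.
pose c := b + 300 * m + 200.
(* [c ^ 2] makes the surviving set [V] large, [4 * m] pays for the edges at [W], and [200] exceeds
   the [2 * (48 + 48)] coming from two sparse parts. *)
exists (c ^ 2 + 4 * m + 200) => n s G n0 ns sG; apply: contraNT; rewrite -ltnNge => large.
set K := (c ^ 2 + 4 * m + 200) * n * s in large.
set e := rel_of G; have esym : symmetric e := @rel_of_sym _ G.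
have eirr : irreflexive e := rel_of_irr sG.
have s0 : 0 < s by rewrite lt0n; apply: contraTneq ns => ->; rewrite exp0n; lia.
have [|V [_ KV degV]] := @half_degree _ e setT K esym eirr.
  by rewrite (degsum_edges sG) cardsT card_ord; move: large; rewrite -/K; lia.
have Vn : #|V| <= n by rewrite -[n in _ <= n]card_ord max_card.
have degsumV : degsum e V <= #|V| ^ 2.
  by rewrite expnS expn1 -sum_nat_const; apply: leq_sum => x _; apply: deg_le_card.
(* The surplus gives [K <= #|V| ^ 2], and [K] is at least [c ^ 2]. *)
have c_le : c <= #|V|.
  rewrite -leq_sqr; have : c ^ 2 * 1 <= c ^ 2 * (n * s).
    by rewrite leq_mul2l muln_gt0 n0 s0 orbT.
  by move: KV degsumV; rewrite /K; lia.
have [|Wm] := leqP m #|[set x in V | #|V| ^ 2 <= 20 * 1000 * #|link e V x|]|.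
  by move=> mW; apply: (contains_TP4_of_K5 eirr); apply: dense mW; rewrite /c in c_le; lia.
have [|A [B [AB dAB dA dB]]] := bipartition degV (ltnW Wm).
  by rewrite /c in c_le; lia.
set W := [set x in V | _] in Wm AB.
have WV : W \subset V by apply/subsetP => x; rewrite inE => /andP[].
have leVW : degsum e V <= degsum e (V :\: W) + 2 * m * #|V|.
  apply: leq_trans (degsum_setD e (subsetDl V W)) _; rewrite leq_add2l leq_mul2r.
  rewrite setDDr setDv set0U leq_mul2l; apply/orP; right.
  by apply: leq_trans (ltnW Wm); apply/subset_leq_card/subsetIr.
have leAB := degsum_setU esym dAB.
have cAB : #|A| + #|B| <= #|V|.
  rewrite -cardsUI disjoint_setI0 // cards0 addn0 AB.
  by apply/subset_leq_card/subsetDl.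
have prodAB : 4 * (#|A| * #|B|) <= #|V| ^ 2.
  apply: leq_trans (_ : (#|A| + #|B|) ^ 2 <= _); last by rewrite leq_sqr.
  by have := nat_AGM2 #|A| #|B|; move=> [+ _].
have K_ge : (4 * m + 200) * #|V| * s <= K.
  rewrite /K; do 2! [apply: leq_mul => //]; lia.
have V0 : 0 < #|V| by rewrite /c in c_le; lia.
have ge1 : m * #|V| * 1 <= m * #|V| * s by rewrite leq_mul2l s0 orbT.
have ge2 : 0 < s * #|V| by rewrite muln_gt0 s0.
rewrite AB in leAB.
(* Edges between the parts contribute at most [#|V| ^ 2 / 2] to the degree sum, so the surplus [K]
   makes [B] dense when [A] is sparse. *)
have [dense_part|sparse_part] := ltnP (48 * s * #|V|) (degsum e A).
  apply: (@contains_TP4_of_bipartition _ G V W A B m n s) => //; first exact: ltnW.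
  by rewrite /c in c_le; lia.
apply: (@contains_TP4_of_bipartition _ G V W B A m n s) => //.
- exact: ltnW.
- by rewrite /c in c_le; lia.
- by rewrite setUC.
- by rewrite disjoint_sym.
- by rewrite -/e; lia.
Qed.

(** * The incidence graph of points and lines *)

Import Order.TTheory GRing.Theory Num.Theory.

Definition edges_of (T : finType) (e : rel T) : {set {set T}} :=
  [set [set p.1; p.2] | p in [set p : T * T | e p.1 p.2]].

Lemma edges_ofE (T : finType) (e : rel T) :
  symmetric e -> rel_of (edges_of e) =2 e.
Proof.
move=> esym x y; apply/imsetP/idP => [[[u v]]|exy]; last by exists (x, y); rewrite ?inE.
rewrite inE /= => euv eqxy.
have xi : x \in [set u; v] by rewrite -eqxy !inE eqxx.
have yi : y \in [set u; v] by rewrite -eqxy !inE eqxx orbT.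
have ui : u \in [set x; y] by rewrite eqxy !inE eqxx.
have vi : v \in [set x; y] by rewrite eqxy !inE eqxx orbT.
move: ui vi; move: xi yi; rewrite !inE.
case/orP=> /eqP-> /orP[]/eqP-> //; rewrite ?orbb.
- by move=> _ /eqP vu; move: euv; rewrite vu.
- by rewrite esym.
- by move=> /eqP uv _; move: euv; rewrite uv.
Qed.

Lemma edges_of_simple (T : finType) (e : rel T) :
  irreflexive e -> simple_graph (edges_of e).
Proof.
move=> eirr; apply/forall_inP => E /imsetP[[u v]]; rewrite inE /= => euv ->.
by rewrite cards2; have [uv|//] := eqVneq u v; move: euv; rewrite uv eirr.
Qed.

(** Converse reading of a copy, by pairs of naturals in place of dependent indices. Outside
    [p.2 <= p.1 <= 4] the values of [g] are arbitrary, because of [inord]. *)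
Lemma contains_TP4_inv (T : finType) (G : {set {set T}}) : contains_copy (TP 4) G ->
  exists g : nat * nat -> T,
    {in [pred p | p.2 <= p.1 <= 4] &, injective g} /\
    forall i j, j <= i ->
      [/\ i <= 4 -> j < i -> rel_of G (g (i, j)) (g (i, j.+1)),
          i < 4 -> rel_of G (g (i, j)) (g (i.+1, j)) &
          i < 4 -> rel_of G (g (i, j)) (g (i.+1, j.+1))].
Proof.
case/existsP => f /andP[/injectiveP finj /forall_inP fG].
pose v (p : nat * nat) : TP_vertex 4 :=
  @Tagged 'I_5 (inord p.1) (fun i => 'I_i.+1) (inord p.2).
have layer_v p : p.2 <= p.1 <= 4 -> layer (v p) = p.1.
  by move=> /andP[_ p1]; rewrite /layer /= inordK.
have pos_v p : p.2 <= p.1 <= 4 -> pos (v p) = p.2.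
  by move=> /andP[p2 p1]; rewrite /pos /= inordK // inordK.
have arc p p' : p.2 <= p.1 <= 4 -> p'.2 <= p'.1 <= 4 ->
    (p'.1 == p.1) && (p'.2 == p.2.+1) ||
    (p'.1 == p.1.+1) && ((p'.2 == p.2) || (p'.2 == p.2.+1)) ->
    rel_of G (f (v p)) (f (v p')).
  move=> vp vp' arcp; rewrite /rel_of.
  have -> : [set f (v p); f (v p')] = f @: [set v p; v p'] by rewrite imsetU !imset_set1.
  apply: fG.
  by apply/imset2P; exists (v p) (v p') => //; rewrite inE /= /TP_arc !layer_v // !pos_v.
exists (fun p => f (v p)); split=> [p p'|i j ji].
  rewrite !inE => vp vp' /finj eqv; rewrite [p]surjective_pairing [p']surjective_pairing.
  by rewrite -(layer_v p) // -(pos_v p) // eqv layer_v // pos_v.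
split=> *; apply: arc => /=; rewrite ?eqxx ?orbT //; lia.
Qed.

Section Wenger.
Variable F : finFieldType.
Local Open Scope ring_scope.

Definition point : finType := (F * F * F)%type.

(* [(t, b, c)] lies on the line [(x, u, v)] through [(0, u, v)] of direction
   [(1, x, x ^+ 2)]. *)
Definition incident (p l : point) : bool :=
  (p.1.2 == l.1.2 + p.1.1 * l.1.1) && (p.2 == l.2 + p.1.1 * l.1.1 ^+ 2).

(* Three distinct directions [(1, x, x ^+ 2)] are linearly independent. *)
Lemma no_triangle_of_lines (p0 p2 p4 l1 l3 l5 : point) :
  uniq [:: p0; p2; p4] -> uniq [:: l1; l3; l5] ->
  incident p0 l1 -> incident p2 l1 -> incident p2 l3 -> incident p4 l3 ->
  incident p4 l5 -> incident p0 l5 -> False.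
Proof.
(* Two lines of the same direction through a common point coincide. *)
have line_neq p l l' : incident p l -> incident p l' -> l != l' -> l.1.1 != l'.1.1.
  case: p l l' => [[t b] c] [[x u] v] [[x' u'] v'] /andP[/= /eqP-> /eqP->].
  move=> /andP[/= /eqP eb /eqP ec]; apply: contra => /eqP xx'; move: eb ec; rewrite xx'.
  by move=> /addIr-> /addIr->.
have point_neq p p' l : incident p l -> incident p' l -> p != p' -> p.1.1 != p'.1.1.
  case: p p' l => [[t b] c] [[t' b'] c'] [[x u] v] /andP[/= /eqP-> /eqP->].
  by move=> /andP[/= /eqP-> /eqP->]; apply: contra => /eqP->.
move=> up ul i01 i21 i23 i43 i45 i05.
move: ul up; rewrite /= !inE !negb_or !andbT => /andP[/andP[l13 l15] l35].
move=> /andP[/andP[p02 p04] p24].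
have := line_neq _ _ _ i23 i21; rewrite eq_sym => /(_ l13).
have := line_neq _ _ _ i43 i45 l35.
have := point_neq _ _ _ i23 i43 p24.
move: i01 i21 i23 i43 i45 i05 {line_neq point_neq l13 l15 l35 p02 p04 p24}.
case: p0 p2 p4 l1 l3 l5 => [[t0 b0] c0] [[t2 b2] c2] [[t4 b4] c4].
move=> [[x1 u1] v1] [[x3 u3] v3] [[x5 u5] v5]; rewrite /incident /=.
move=> /andP[/eqP b01 /eqP c01] /andP[/eqP b21 /eqP c21] /andP[/eqP b23 /eqP c23].
move=> /andP[/eqP b43 /eqP c43] /andP[/eqP b45 /eqP c45] /andP[/eqP b05 /eqP c05] t24 x35 x31.
(* The displacements along the three sides sum to zero; [E1] and [E2] are the last two
   coordinates. *)
have E1 : (t0 - t2) * x1 + (t2 - t4) * x3 + (t4 - t0) * x5 = 0.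
  have -> : (t0 - t2) * x1 + (t2 - t4) * x3 + (t4 - t0) * x5 =
    ((u1 + t0 * x1) - (u1 + t2 * x1)) + ((u3 + t2 * x3) - (u3 + t4 * x3))
    + ((u5 + t4 * x5) - (u5 + t0 * x5)) by ring.
  by rewrite -b01 -b21 -b23 -b43 -b45 -b05; ring.
have E2 : (t0 - t2) * x1 ^+ 2 + (t2 - t4) * x3 ^+ 2 + (t4 - t0) * x5 ^+ 2 = 0.
  have -> : (t0 - t2) * x1 ^+ 2 + (t2 - t4) * x3 ^+ 2 + (t4 - t0) * x5 ^+ 2 =
    ((v1 + t0 * x1 ^+ 2) - (v1 + t2 * x1 ^+ 2)) + ((v3 + t2 * x3 ^+ 2) - (v3 + t4 * x3 ^+ 2))
    + ((v5 + t4 * x5 ^+ 2) - (v5 + t0 * x5 ^+ 2)) by ring.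
  by rewrite -c01 -c21 -c23 -c43 -c45 -c05; ring.
(* Subtracting [x1 + x5] times [E1] from [E2] yields this Vandermonde-like product, whose factors
   are all nonzero. *)
have : (t2 - t4) * (x3 - x5) * (x3 - x1) = 0.
  transitivity ((t0 - t2) * x1 ^+ 2 + (t2 - t4) * x3 ^+ 2 + (t4 - t0) * x5 ^+ 2
    - (x1 + x5) * ((t0 - t2) * x1 + (t2 - t4) * x3 + (t4 - t0) * x5)); first by ring.
  by rewrite E1 E2 mulr0 subr0.
by move/eqP; rewrite !mulf_eq0 !subr_eq0 (negPf t24) (negPf x35) (negPf x31).
Qed.

(** A Wenger graph: bipartite with [2 * #|F| ^ 3] vertices, points on the left and lines on the
    right. *)
Definition wenger : rel (point + point)%type := fun a b =>
  match a, b with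
  | inl p, inr l => incident p l
  | inr l, inl p => incident p l
  | _, _ => false
  end.

Lemma wenger_sym : symmetric wenger.
Proof. by case=> [p|l] [p'|l']. Qed.

Lemma wenger_hexagon_free : ~ has_hexagon wenger.
Proof.
have from_point p s : size s = 5%N -> uniq (inl p :: s) -> cycle wenger (inl p :: s) -> False.
  case: s => [|a1 [|a2 [|a3 [|a4 [|a5 [|//]]]]]] // _.
  move: a1 a2 a3 a4 a5 => [//|l1] [p2|l2] [p3|l3] [p4|l4] [p5|l5] us;
    rewrite /= ?andbF // andbT.
  move=> /and5P[i01 i21 i23 i43 /andP[i45 i05]].
  apply: (@no_triangle_of_lines p p2 p4 l1 l3 l5) => //.
    have := mask_uniq us [:: true; false; true; false; true].
    by rewrite -[mask _ _]/(map inl [:: p; p2; p4]) map_inj_uniq //; apply: inl_inj.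
  have := mask_uniq us [:: false; true; false; true; false; true].
  by rewrite -[mask _ _]/(map inr [:: l1; l3; l5]) map_inj_uniq //; apply: inr_inj.
case=> -[|[p|l] s] // [s5] [us cs]; first exact: (from_point p s).
(* A cycle starting at a line is rotated by one place. *)
case: s s5 us cs => [|[p|l'] s] // [s4] us cs.
apply: (from_point p (rcons s (inr l))); first by rewrite size_rcons s4.
  by rewrite -(rot_uniq 1) in us; rewrite -rcons_cons -cats1.
by rewrite -(rot_cycle 1) in cs; rewrite -rcons_cons -cats1.
Qed.

(** A point lies on one line of each direction; a line has one point for each first coordinate. *)
Lemma wenger_degree a : (#|F| <= #|[set b | wenger a b]|)%N.
Proof.
case: a => [[[t b] c]|[[x u] v]].
  have inj : injective (fun x => inr (x, b - t * x, c - t * x ^+ 2) : point + point).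
    by move=> x x' [].
  rewrite -cardsT -(card_imset _ inj); apply/subset_leq_card/subsetP => a.
  by case/imsetP => x _ ->; rewrite inE /= /incident /= !subrK !eqxx.
have inj : injective (fun t => inl (t, u + t * x, v + t * x ^+ 2) : point + point).
  by move=> t t' [].
rewrite -cardsT -(card_imset _ inj); apply/subset_leq_card/subsetP => a.
by case/imsetP => t _ ->; rewrite inE /= /incident /= !eqxx.
Qed.

End Wenger.

(** * The lower bound *)

Section Join.
Variables (U T : finType) (r : rel U) (g : U -> T) (A : {set T}).
Hypotheses (rsym : symmetric r) (rirr : irreflexive r).
Hypotheses (ginj : injective g) (gA : forall u, g u \in A).

Definition image_rel : rel T :=
  fun x y => [exists u, exists v, [&& g u == x, g v == y & r u v]].
Definition join_rel : rel T := fun x y => ((x \in A) != (y \in A)) || image_rel x y.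

Lemma image_relP x y : reflect (exists u v, [/\ x = g u, y = g v & r u v]) (image_rel x y).
Proof.
apply: (iffP existsP) => [[u /existsP[v /and3P[/eqP<- /eqP<- ruv]]]|[u [v [-> -> ruv]]]].
  by exists u, v.
by exists u; apply/existsP; exists v; rewrite !eqxx.
Qed.

Lemma image_relE u v : image_rel (g u) (g v) = r u v.
Proof.
apply/image_relP/idP => [[u' [v' [/ginj-> /ginj->]]]//|ruv]; by exists u, v.
Qed.

Lemma image_rel_sym : symmetric image_rel.
Proof.
by move=> x y; apply/image_relP/image_relP => -[u [v [-> -> ruv]]]; exists v, u; rewrite rsym.
Qed.

Lemma join_rel_sym : symmetric join_rel.
Proof. by move=> x y; rewrite /join_rel eq_sym image_rel_sym. Qed.

Lemma join_rel_irr : irreflexive join_rel.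
Proof.
move=> x; rewrite /join_rel eqxx orFb; apply/negbTE/negP.
case/image_relP=> [u [v [-> /ginj<- ruu]]].
by rewrite rirr in ruu.
Qed.

Lemma join_rel_in x y : x \in A -> y \in A -> join_rel x y = image_rel x y.
Proof. by rewrite /join_rel => -> ->; rewrite eqxx. Qed.

Lemma join_rel_out x y : x \notin A -> y \notin A -> join_rel x y = false.
Proof.
rewrite /join_rel => /negPf xA /negPf yA; rewrite xA yA eqxx orFb.
by apply/negbTE/negP => /image_relP[u [v [xu _ _]]]; move: xA; rewrite xu gA.
Qed.

(** Every vertex on the cycle is an end of an image edge, so the cycle lifts through [g]. *)
Lemma image_hexagon s : size s = 6 -> uniq s -> cycle image_rel s -> has_hexagon r.
Proof.
move=> s6 us cs.
have sg x : x \in s -> exists u, x = g u.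
  move=> /(next_cycle cs)/image_relP[u [v [-> _ _]]]; by exists u.
have {sg}[t st] : exists t, s = map g t.
  elim: s sg {s6 us cs} => [|x s IH] sg; first by exists [::].
  have [u ->] := sg x (mem_head _ _).
  have [|t ->] := IH; last by exists (u :: t).
  by move=> y ys; apply: sg; rewrite inE ys orbT.
exists t; first by move: s6; rewrite st size_map.
split; first by move: us; rewrite st map_inj_uniq.
move: cs; rewrite st; case: t {st} => //= u t; rewrite -map_rcons.
move: (rcons t u) => l; elim: l u => //= v l IH w; by rewrite image_relE => /andP[-> /IH].
Qed.

Lemma join_degsum d : (forall u, d <= #|[set v | r u v]|) ->
  2 * (#|A| * #|~: A|) + #|U| * d <= degsum join_rel setT.
Proof.
move=> degr; rewrite /degsum (big_setID A) /= setTI setTD.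
have leA : \sum_(x in A) (deg image_rel A x + #|~: A|) <= \sum_(x in A) deg join_rel setT x.
  apply: leq_sum => x xA; rewrite (deg_setID join_rel A setT) setTI setTD leq_add //.
    apply/subset_leq_card/subsetP => y; rewrite !inE => /andP[yA].
    by rewrite yA join_rel_in.
  apply/subset_leq_card/subsetP => y; rewrite !inE => yA.
  by rewrite yA /join_rel xA (negPf yA).
have leB : #|~: A| * #|A| <= \sum_(x in ~: A) deg join_rel setT x.
  rewrite -sum_nat_const; apply: leq_sum => x; rewrite inE => xA.
  by apply/subset_leq_card/subsetP => y; rewrite !inE /join_rel (negPf xA) => ->.
have leU : #|U| * d <= \sum_(x in A) deg image_rel A x.
  rewrite -sum_nat_const; apply: leq_trans (_ : \sum_(u in U) deg image_rel A (g u) <= _).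
    apply: leq_sum => u _; apply: leq_trans (degr u) _.
    rewrite -(card_imset _ ginj); apply/subset_leq_card/subsetP => y.
    by case/imsetP => v; rewrite inE => ruv ->; rewrite inE gA image_relE.
  rewrite -(big_imset (fun x => deg image_rel A x)) /=; last by move=> u v _ _ /ginj.
  rewrite [X in _ <= X](big_setID (g @: U)) /=.
  rewrite (setIidPr _) ?leq_addr //; by apply/subsetP => y /imsetP[u _ ->].
move: leA; rewrite big_split sum_nat_const /= => leA; rewrite mulnC in leB.
apply: leq_trans (leq_add leA leB); rewrite -addnA addnn -mul2n addnC leq_add2r.
exact: leU.
Qed.

(** If one of the interior vertices [(2, 1)], [(3, 1)], [(3, 2)] lies outside [A], its six
    neighbours form a hexagon inside [A]. Otherwise all three lie in [A] and give a triangle of [r],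
    which the colouring [c] forbids. *)
Lemma join_TP4_free :
  (exists c : U -> bool, forall u v, r u v -> c u != c v) -> ~ has_hexagon r ->
  ~~ contains_copy (TP 4) (edges_of join_rel).
Proof.
move=> [c rc] nohex; apply/negP => /contains_TP4_inv[f [finj farc]].
have eE := edges_ofE join_rel_sym.
(* No edge joins two vertices outside [A], so all neighbours of [o] are in [A], where only image
   edges occur. *)
have center o s : size s = 6 -> o \notin [pred p | f p \in A] ->
    all [pred p | p.2 <= p.1 <= 4] s -> uniq s ->
    all (fun p => join_rel (f o) (f p)) s ->
    cycle (fun p p' => join_rel (f p) (f p')) s -> False.
  move=> s6 oA sv us so cs; apply: nohex; apply: (@image_hexagon (map f s)).
  - by rewrite size_map.
  - rewrite map_inj_in_uniq // => p p' ps p's; apply: finj; exact: (allP sv).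
  have sA p : p \in s -> f p \in A.
    move=> /(allP so); apply: contraTT => pA; by rewrite join_rel_out.
  rewrite cycle_map; apply: sub_in_cycle cs; last by apply/allP => p; apply: sA.
  by move=> p p' /= pA p'A; rewrite join_rel_in.
have hE i j : j <= i -> i <= 4 -> j < i -> join_rel (f (i, j)) (f (i, j.+1)).
  by move=> ji i4 lt; rewrite -eE; have [/(_ i4 lt)] := farc i j ji.
have vE i j : j <= i -> i < 4 -> join_rel (f (i, j)) (f (i.+1, j)).
  by move=> ji i4; rewrite -eE; have [_ /(_ i4)] := farc i j ji.
have dE i j : j <= i -> i < 4 -> join_rel (f (i, j)) (f (i.+1, j.+1)).
  by move=> ji i4; rewrite -eE; have [_ _ /(_ i4)] := farc i j ji.
have hE' i j : j <= i -> i <= 4 -> j < i -> join_rel (f (i, j.+1)) (f (i, j)).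
  by move=> *; rewrite join_rel_sym hE.
have vE' i j : j <= i -> i < 4 -> join_rel (f (i.+1, j)) (f (i, j)).
  by move=> *; rewrite join_rel_sym vE.
have dE' i j : j <= i -> i < 4 -> join_rel (f (i.+1, j.+1)) (f (i, j)).
  by move=> *; rewrite join_rel_sym dE.
have [aA|aA] := boolP (f (2, 1) \in A); last first.
  apply: (center (2, 1) [:: (1, 0); (1, 1); (2, 2); (3, 2); (3, 1); (2, 0)]) => //=.
    rewrite andbT; do ?[apply/andP; split];
      by [apply: hE|apply: hE'|apply: vE|apply: vE'|apply: dE|apply: dE'].
  rewrite andbT; do ?[apply/andP; split];
    by [apply: hE|apply: hE'|apply: vE|apply: vE'|apply: dE|apply: dE'].
have [bA|bA] := boolP (f (3, 1) \in A); last first.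
  apply: (center (3, 1) [:: (2, 0); (2, 1); (3, 2); (4, 2); (4, 1); (3, 0)]) => //=.
    rewrite andbT; do ?[apply/andP; split];
      by [apply: hE|apply: hE'|apply: vE|apply: vE'|apply: dE|apply: dE'].
  rewrite andbT; do ?[apply/andP; split];
    by [apply: hE|apply: hE'|apply: vE|apply: vE'|apply: dE|apply: dE'].
have [cA|cA] := boolP (f (3, 2) \in A); last first.
  apply: (center (3, 2) [:: (2, 1); (2, 2); (3, 3); (4, 3); (4, 2); (3, 1)]) => //=.
    rewrite andbT; do ?[apply/andP; split];
      by [apply: hE|apply: hE'|apply: vE|apply: vE'|apply: dE|apply: dE'].
  rewrite andbT; do ?[apply/andP; split];
    by [apply: hE|apply: hE'|apply: vE|apply: vE'|apply: dE|apply: dE'].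
have := vE 2 1 isT isT; rewrite join_rel_in // => /image_relP[u [v [eu ev ruv]]].
have := dE 2 1 isT isT; rewrite join_rel_in // eu => /image_relP[u' [w [/ginj<- ew ruw]]].
have := hE 3 1 isT isT isT; rewrite join_rel_in // ev ew image_relE => rvw.
by move: (rc _ _ ruv) (rc _ _ ruw) (rc _ _ rvw); case: (c u); case: (c v); case: (c w).
Qed.

End Join.

(** [4 * #|F| ^ 3 <= n] lets the incidence graph fit into the lower half of the vertices. *)
Lemma ex_TP4_lower (F : finFieldType) (n : nat) : 4 * #|F| ^ 3 <= n ->
  n ^ 2 + 4 * #|F| ^ 4 <= 4 * ex n (TP 4) + 1.
Proof.
move=> Fn; pose U : finType := (point F + point F)%type.
have cU : #|U| = 2 * #|F| ^ 3.
  by rewrite card_sum /point !card_prod addnn -mul2n !expnS expn0 muln1 -!mulnA.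
have Un : #|U| <= n by rewrite cU; lia.
pose g (u : U) : 'I_n := widen_ord Un (enum_rank u).
have ginj : injective g by move=> u v /(congr1 val) /= /val_inj/enum_rank_inj.
pose A := [set i : 'I_n | i < n./2].
have gA u : g u \in A.
  rewrite inE /=; apply: leq_trans (ltn_ord _) _; rewrite cU; lia.
have hn : n./2 <= n by lia.
have cA : #|A| = n./2.
  have inj : injective (widen_ord hn) by move=> i j /(congr1 val) /= /val_inj.
  rewrite -[RHS]card_ord -cardsT -(card_imset _ inj); apply: eq_card => i.
  rewrite inE; apply/idP/imsetP => [ih|[j _ ->]]; last exact: (ltn_ord j).
  by exists (Ordinal ih) => //; apply: val_inj.
have cAC : #|~: A| = n - n./2 by rewrite cardsCs setCK cA card_ord.
have wirr : irreflexive (@wenger F) by case.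
pose G := edges_of (join_rel (@wenger F) g A).
have jsym := @join_rel_sym _ _ _ g A (@wenger_sym F).
have jirr := @join_rel_irr _ _ _ g A wirr ginj.
have sG : simple_graph G := edges_of_simple jirr.
have freeG : ~~ contains_copy (TP 4) G.
  apply: join_TP4_free => //; first exact: wenger_sym.
    exists (fun a => if a is inl _ then true else false).
    by case=> [p|l] [p'|l'].
  exact: wenger_hexagon_free.
have leG : #|G| <= ex n (TP 4).
  by apply: (leq_bigmax_cond (F := fun G : {set {set 'I_n}} => #|G|)); rewrite sG.
have := join_degsum ginj gA (@wenger_degree F).
rewrite cA cAC -/U cU -(eq_degsum (e := rel_of G)) => [|x y _ _]; last exact: edges_ofE.
rewrite degsum_edges //.
have -> : 2 * #|F| ^ 3 * #|F| = 2 * #|F| ^ 4 by rewrite [in RHS]expnSr mulnA.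
(* The [+ 1] covers odd [n], where the two parts differ in size by one. *)
have : n ^ 2 <= 4 * (n./2 * (n - n./2)) + 1.
  have [k [->|->]] : exists k, n = 2 * k \/ n = 2 * k + 1 by exists n./2; lia.
    rewrite (_ : (2 * k)./2 = k); last lia.
    rewrite (_ : 2 * k - k = k); last lia.
    rewrite expnMn expnS expn1; lia.
  rewrite (_ : (2 * k + 1)./2 = k); last lia.
  rewrite (_ : 2 * k + 1 - k = k + 1); last lia.
  rewrite expnS expn1; lia.
lia.
Qed.

(** * Real exponents and the asymptotic statement *)

Local Open Scope ring_scope.

(** Replaces the real power by a cube root [y], so that the remaining estimates are polynomial. *)
Lemma powR_four_thirds (R : realType) (n : nat) : (0 < n)%N ->
  exists y : R, [/\ 0 < y, y ^+ 3 = n%:R & n%:R `^ (4%:R / 3%:R) = n%:R * y].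
Proof.
move=> n0; have nR : 0 < n%:R :> R by rewrite ltr0n.
exists (n%:R `^ (1 / 3%:R)); split; first exact: powR_gt0.
  by rewrite -powR_mulrn ?powR_ge0 // -powRrM mul1r mulVf ?pnatr_eq0 // powRr1 // ltW.
have -> : 4%:R / 3%:R = 1 + 1 / 3%:R :> R by field.
by rewrite powRD ?powRr1 ?ltW // (gt_eqF nR) implybT.
Qed.

Lemma ex_TP4_upper : exists C : nat, forall n s : nat,
  (0 < n)%N -> (n <= s ^ 3)%N -> (4 * ex n (TP 4) <= n ^ 2 + C * n * s)%N.
Proof.
have [C upper] := TP4_free_edges; exists C => n s n0 ns.
rewrite mulnC -leq_divRL //; apply/bigmax_leqP => G /andP[sG freeG].
by rewrite leq_divRL // mulnC; apply: upper.
Qed.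

Lemma cube_root_up (n : nat) : (0 < n)%N -> exists s : nat, (s ^ 3 < n <= s.+1 ^ 3)%N.
Proof.
move=> n0; have ex_s : exists s, (n <= s.+1 ^ 3)%N.
  by exists n; rewrite !expnS expn0; nia.
case: (ex_minnP ex_s) => s le_s min_s; exists s; rewrite le_s andbT.
by case: s le_s min_s => // s _ min_s; rewrite ltnNge; apply/negP => /min_s; rewrite ltnn.
Qed.

(** Take [#|F| = 2 ^ k] with [8 ^ k] the largest power of 8 up to [n %/ 4]; maximality gives the
    factor 32, and [32 <= n] gives a positive [k]. *)
Lemma field_order (n : nat) : (32 <= n)%N -> exists F : finFieldType,
  (4 * #|F| ^ 3 <= n)%N /\ (n < 32 * #|F| ^ 3)%N /\ (2 <= #|F|)%N.
Proof.
move=> n32; have n4 : (8 <= n %/ 4)%N by lia.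
have /andP[lo hi] := trunc_log_bounds (isT : (1 < 8)%N) (leq_trans (isT : (0 < 8)%N) n4).
have k0 : (0 < trunc_log 8 (n %/ 4))%N.
  by rewrite lt0n; apply: contraTneq hi => ->; rewrite -leqNgt.
have [F _ cF] := @pPrimePowerField 2 _ isT k0; exists F.
have -> : (#|F| ^ 3 = 8 ^ trunc_log 8 (n %/ 4))%N by rewrite cF -expnM mulnC expnM.
rewrite cF; split; last split.
- lia.
- rewrite expnS in hi; lia.
- by rewrite -{1}[2%N]expn1 leq_exp2l.
Qed.

Theorem theorem1p4 (R : realType) :
  exists c C : R, exists n0 : nat,
    [/\ 0 < c, 0 < C &
      forall n : nat, (n0 <= n)%N ->
        n%:R ^+ 2 / 4%:R + c * n%:R `^ (4%:R / 3%:R) <= (ex n (TP 4))%:R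
        <= n%:R ^+ 2 / 4%:R + C * n%:R `^ (4%:R / 3%:R)].
Proof.
have [C upper] := ex_TP4_upper.
(* Below, [n * y] is at most [128 * q ^ 4], so [1 / 256] costs half of the gain [q ^ 4] and the
   other half covers the parity loss [1 / 4]. The [+ 1] keeps the upper constant positive. *)
exists (1 / 256%:R), (C%:R + 1), 32%N; split.
- by rewrite divr_gt0 ?ltr0n.
- by rewrite ltr_wpDl ?ler0n ?ltr01.
move=> n n32; have n0 : (0 < n)%N by apply: leq_trans n32.
have [y [y0 y3 ->]] := powR_four_thirds R n0.
have ler_cube (a b : R) : 0 <= a -> 0 <= b -> a ^+ 3 <= b ^+ 3 -> a <= b.
  by move=> a0 b0; rewrite ler_pXn2r.
apply/andP; split.
  have [F [Fn [nF F2]]] := field_order n32.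
  have := ex_TP4_lower Fn; rewrite -(ler_nat R) !(natrD, natrX, natrM) => low.
  set q : R := #|F|%:R in low.
  have q2 : 2 <= q by rewrite ler_nat.
  have nq : n%:R <= 32%:R * q ^+ 3 by rewrite -natrX -natrM ler_nat ltnW.
  (* Cubes are compared: [y ^ 3 = n] is at most [32 * q ^ 3], below [64 * q ^ 3]. *)
  have yq : y <= 4%:R * q.
    by apply: ler_cube; [exact: ltW | lra | rewrite y3 exprMn; nra].
  have : n%:R * y <= 32%:R * q ^+ 3 * (4%:R * q) by apply: ler_pM => //; exact: ltW.
  have -> : 32%:R * q ^+ 3 * (4%:R * q) = 128%:R * q ^+ 4 by ring.
  have : 1 <= q ^+ 4 by apply: exprn_ege1; lra.
  lra.
have [s /andP[sn ns]] := cube_root_up n0.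
have := upper n s.+1 n0 ns; rewrite -(ler_nat R) !(natrD, natrX, natrM) => up.
(* With [1 <= y] this bounds [s.+1] by [2 * y]. *)
have sy : s%:R <= y.
  by apply: ler_cube; rewrite ?ler0n ?ltW // y3 -natrX ltr_nat.
have y1 : 1 <= y.
  by apply: ler_cube; [exact: ler01 | exact: ltW | rewrite y3 expr1n (ler_nat R 1)].
have C0 : 0 <= C%:R * n%:R :> R by rewrite mulr_ge0 ?ler0n.
have : C%:R * n%:R * s.+1%:R <= C%:R * n%:R * (2%:R * y) :> R.
  by apply: ler_wpM2l => //; rewrite -addn1 natrD; lra.
have : 0 <= n%:R * y by rewrite mulr_ge0 ?ler0n ?ltW.
have : 0 <= C%:R * (n%:R * y) by rewrite !mulr_ge0 ?ler0n ?ltW.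
lra.
Qed.
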